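(* Let $$S_0(z):=\frac{\mathrm{Li}_3(1)}{\mathrm{Li}_3(1)-\mathrm{Li}_3(z)}$$ and let $S_n:=[z^n]S_0(z)$ be the coefficient of $z^n$ in the power series expansion of $S_0$ at $z=0$. Then, as $n\to\infty$, $$S_n=\frac{6\zeta(3)}{\pi^2}+\frac{18\zeta(3)}{\pi^4 n}+\frac{3\zeta(3)\left(-18\pi^2-36\pi^2\ln(n)-36\pi^2\gamma\right)}{\pi^8n^2}+\frac{3\zeta(3)\left(-42\pi^2-405+324\gamma^2+324\ln(n)^2+648\ln(n)\gamma\right)}{\pi^8n^3}+O\!\left(\frac{1}{n^4}\right).$$
   Context: $\mathrm{Li}_3(z):=\sum_{n=1}^{\infty}\frac{z^n}{n^3}$ is the polylogarithm of order $3$, $\zeta$ is the Riemann zeta function (so $\mathrm{Li}_3(1)=\zeta(3)$), $\gamma$ is Euler's constant, and $\ln(n)^2$ means $(\ln n)^2$.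
   Formalization: The error term O(1/n^4) is replaced by O((ln n)^3/n^4): the literal bound is false, since the next term of the expansion is -(3/2) ζ(3)/ζ(2)^5 (ln n)^3/n^4 to leading order. *)

(* Defs.v *)
From Stdlib Require Import Reals.
From Coquelicot Require Import Coquelicot.

Open Scope R_scope.

(* Sum of a complex series, taken componentwise because [Series] is real;
   meaningful only when both component series converge. *)
Definition CSeries (a : nat -> C) : C :=
  (Series (fun n => Re (a n)), Series (fun n => Im (a n))).

(* Series starting at n = 1 are shifted to start at 0. Meaningful for
   [Cmod z <= 1]. *)
Definition Li3 (z : C) : C :=
  CSeries (fun n => Cdiv (Cpow z (S n)) (Cpow (RtoC (INR (S n))) 3)).

(* Meaningful for s > 1. *)
Definition zeta (s : R) : R := Series (fun n => / Rpower (INR (S n)) s).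

Definition euler_gamma : R :=
  real (Lim_seq (fun n => sum_n_m (fun k => / INR k) 1 n - ln (INR n))).

(* [a n] is the coefficient of z^n in the power series expansion of [f] at 0.
   At most one sequence satisfies this. *)
Definition power_series_at_0 (f : C -> C) (a : nat -> C) : Prop :=
  exists r : R, 0 < r /\
    forall z : C, Cmod z < r -> @is_pseries C_AbsRing C_NormedModule a z (f z).

Definition bigO (u : nat -> C) (g : nat -> R) : Prop :=
  exists (K : R) (N : nat),
    forall n : nat, (N <= n)%nat -> Cmod (u n) <= K * Rabs (g n).

Definition S0 (z : C) : C := Cdiv (Li3 1) (Cminus (Li3 1) (Li3 z)).

Definition S_expansion (n : nat) : R :=
  let x := INR n in
  6 * zeta 3 / PI ^ 2
  + 18 * zeta 3 / (PI ^ 4 * x)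
  + 3 * zeta 3
      * (- 18 * PI ^ 2 - 36 * PI ^ 2 * ln x - 36 * PI ^ 2 * euler_gamma)
      / (PI ^ 8 * x ^ 2)
  + 3 * zeta 3
      * (- 42 * PI ^ 2 - 405 + 324 * euler_gamma ^ 2 + 324 * (ln x) ^ 2
         + 648 * ln x * euler_gamma)
      / (PI ^ 8 * x ^ 3).

(* The remainder term, usually abbreviated O(1/n^4). That abbreviation has to
   be read as in generalized series, where coefficients of powers of 1/n may
   be polynomials in ln n: the next term of the expansion is
   -(3/2) zeta(3)/zeta(2)^5 (ln n)^3/n^4 to leading order, so the bound without
   the logarithms is false and the exponent 3 is optimal. *)
Definition S_remainder (n : nat) : R := (ln (INR n)) ^ 3 / (INR n) ^ 4.

(* Main.v *)
Require Import Defs.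
From Stdlib Require Import Arith Reals Lra Lia FunctionalExtensionality.
From Coquelicot Require Import Coquelicot.

Open Scope R_scope.

(** Real sequences are treated as formal power series, and multiplication by
    [1 - z] is the backward difference.  With [zeta(3) - Li3 = (1 - z) B] and
    [B = zeta(2) - (1 - z) T], the geometric expansion of [1 / B] reads
    [1/((1-z)B) = 1/(zeta(2)(1-z)) + T/zeta(2)^2 + (1-z)T^2/zeta(2)^3
      + (1-z)^2 T^3/zeta(2)^4 + (1-z)^3 T^4 V/zeta(2)^4] where [V = 1/B].
    Coefficients are estimated elementarily, without singularity analysis: a
    sequence is a symbol when its [i]-th difference decays [n^i] times faster
    than itself, and products of symbols are symbols up to powers of [ln n].
    Kaluza's theorem on reciprocals of log-convex sequences gives
    [V_n = O(1/n^2)], and the Euler operator [z d/dz] upgrades this to a symbol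
    estimate.  Hence the last term is [O((ln n)^3/n^4)], and in the others [T]
    may be replaced by its expansion in powers of [1 - z] and [ln(1 - z)],
    whose coefficients are explicit in harmonic numbers. *)

(** * Formal power series *)

(** A bound on the size of a sequence gives nothing better for its differences, so a remainder
    [(1 - z)^3 X] is small only if [X] is known to be regular; hence regularity has to be carried
    through products and through the reciprocal [V]. The expansion stops at [T^4] because three
    differences of a symbol of order 1 have order 4; four factors [T] cost three logarithms, and the
    summable factor [V] costs none.

    The obstacle is [V]: that [1/B] has summable coefficients would normally require excluding zeros
    of [B] on the closed disk. Positivity and log-convexity of [Bs] give the signs of the
    coefficients of [V] instead, and with them a bound, without any analysis. In the same spirit,
    the formal identity [(zeta(3) - Li3) U = 1] shows afterwards that the denominator of [S0] has no
    zero in the open disk.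

    The constants in the expansion of [T] at 1 are affine in [zeta(2)]. Up to the factor
    [zeta(3)/zeta(2)^4], the coefficients sought are thus polynomials in [zeta(2)] and
    [ln n + gamma], and [PI] enters only at the end. *)

Definition shl (x : nat -> R) (n : nat) : R := x (S n).

(** Recursion on the index, peeling off the first coefficient of [x], makes the ring laws short
    inductions; [conv_sum] recovers the usual finite sum. *)
Fixpoint conv (x y : nat -> R) (n : nat) {struct n} : R :=
  match n with
  | O => x O * y O
  | S m => x O * y n + conv (shl x) y m
  end.

Definition fadd (x y : nat -> R) (n : nat) : R := x n + y n.
Definition fopp (x : nat -> R) (n : nat) : R := - x n.
Definition fsub (x y : nat -> R) (n : nat) : R := x n - y n.
Definition delta (k n : nat) : R := if Nat.eqb k n then 1 else 0.
Definition cst (c : R) (n : nat) : R := c * delta 0 n.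
Definition f0 : nat -> R := cst 0.
Definition f1 : nat -> R := cst 1.

Declare Scope fps_scope.
Delimit Scope fps_scope with fps.
Infix "+" := fadd : fps_scope.
Infix "-" := fsub : fps_scope.
Infix "*" := conv : fps_scope.
Notation "- x" := (fopp x) : fps_scope.

Lemma conv_ext (n : nat) : forall x x' y y' : nat -> R,
  (forall k, (k <= n)%nat -> x k = x' k) ->
  (forall k, (k <= n)%nat -> y k = y' k) -> conv x y n = conv x' y' n.
Proof.
induction n as [|n IH]; intros x x' y y' Hx Hy; simpl.
- rewrite Hx, Hy by lia; reflexivity.
- rewrite Hx, Hy by lia. f_equal. apply IH.
  + intros k Hk; apply Hx; lia.
  + intros k Hk; apply Hy; lia.
Qed.

Lemma conv_addl (n : nat) : forall x y z : nat -> R,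
  ((x + y) * z)%fps n = (x * z)%fps n + (y * z)%fps n.
Proof.
induction n as [|n IH]; intros x y z; simpl; unfold fadd at 1.
- ring.
- change (shl (x + y)%fps) with (shl x + shl y)%fps. rewrite IH. ring.
Qed.

Lemma conv_scall (n : nat) : forall (c : R) (x z : nat -> R),
  ((fun k => (c * x k)%R) * z)%fps n = c * (x * z)%fps n.
Proof.
induction n as [|n IH]; intros c x z; simpl.
- ring.
- change (shl (fun k => c * x k)) with (fun k => c * shl x k). rewrite IH. ring.
Qed.

Lemma conv_sym (n : nat) : forall x y : nat -> R, (x * y)%fps n = (y * x)%fps n.
Proof.
assert (H : forall m (x y : nat -> R),
  (x * y)%fps (S m) = (x * shl y)%fps m + x (S m) * y O).
{ induction m as [|m IH]; intros x y.
  - simpl. unfold shl. ring.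
  - change ((x * y)%fps (S (S m))) with (x O * y (S (S m)) + (shl x * y)%fps (S m)).
    rewrite IH. simpl. unfold shl. ring. }
induction n as [|n IH]; intros x y.
- simpl; ring.
- rewrite H. change ((y * x)%fps (S n)) with (y O * x (S n) + (shl y * x)%fps n).
  rewrite IH. ring.
Qed.

Lemma conv_assoc (n : nat) : forall x y z : nat -> R,
  (x * (y * z))%fps n = ((x * y) * z)%fps n.
Proof.
induction n as [|n IH]; intros x y z.
- simpl; ring.
- change ((x * (y * z))%fps (S n)) with
    (x O * (y O * z (S n) + (shl y * z)%fps n) + (shl x * (y * z))%fps n).
  change (((x * y) * z)%fps (S n)) with
    (x O * y O * z (S n) + (shl (x * y) * z)%fps n).
  change (shl (x * y)%fps) with ((fun k => (x O * shl y k)%R) + (shl x * y))%fps.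
  rewrite conv_addl, conv_scall, IH. ring.
Qed.

Lemma conv_0l (n : nat) (y : nat -> R) : conv (fun _ => 0) y n = 0.
Proof.
transitivity (0 * conv (fun _ => 0) y n); [|ring].
rewrite <- conv_scall. apply conv_ext; intros; ring.
Qed.

Lemma conv_cst (c : R) (y : nat -> R) (n : nat) : (cst c * y)%fps n = c * y n.
Proof.
destruct n as [|n]; simpl; unfold cst, delta; simpl.
- ring.
- rewrite (conv_ext n _ (fun _ => 0) _ y), conv_0l; try reflexivity.
  + ring.
  + intros k _. unfold shl; simpl. ring.
Qed.

(** Functional extensionality turns the laws into Leibniz equalities, so that [ring] and plain
    rewriting can do all the algebra in powers of [1 - z]. *)
Lemma fps_ring : ring_theory f0 f1 fadd conv fsub fopp eq.
Proof.
split; intros; apply functional_extensionality; intro n.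
- unfold f0, cst, fadd, delta. destruct (Nat.eqb 0 n); ring.
- unfold fadd; ring.
- unfold fadd; ring.
- unfold f1; rewrite conv_cst; ring.
- apply conv_sym.
- apply conv_assoc.
- apply conv_addl.
- unfold fsub, fadd, fopp; ring.
- unfold f0, cst, fadd, fopp, delta. destruct (Nat.eqb 0 n); ring.
Qed.

Add Ring fps : fps_ring.

(** * Multiplication by [1 - z] and the Euler operator *)

Definition eps : nat -> R := (f1 - delta 1)%fps.
Definition nabla (x : nat -> R) : nat -> R := (eps * x)%fps.
Notation iter_nabla i := (Nat.iter i nabla).

Lemma conv_delta (k : nat) : forall (y : nat -> R) (n : nat),
  (delta k * y)%fps n = if Nat.leb k n then y (n - k)%nat else 0.
Proof.
induction k as [|k IH]; intros y n.
- replace (delta 0) with (cst 1)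
    by (apply functional_extensionality; intro; unfold cst; ring).
  rewrite conv_cst. simpl. rewrite Nat.sub_0_r. ring.
- destruct n as [|n]; simpl.
  + unfold delta; simpl; ring.
  + change (shl (delta (S k))) with (delta k). rewrite IH.
    unfold delta at 1; simpl. ring.
Qed.

Lemma nabla_0 (x : nat -> R) : nabla x 0 = x 0%nat.
Proof. unfold nabla, eps, conv, fsub, f1, cst, delta; simpl; ring. Qed.

Lemma nabla_S (x : nat -> R) (n : nat) : nabla x (S n) = x (S n) - x n.
Proof.
unfold nabla, eps. replace ((f1 - delta 1) * x)%fps with (f1 * x - delta 1 * x)%fps by ring.
unfold fsub, f1. rewrite conv_cst, conv_delta. simpl. rewrite Nat.sub_0_r. ring.
Qed.

(** Cancellation of a factor [1 - z], which is invertible as a formal series; it allows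
    [Us_expansion] to be checked after multiplication by [1 - z]. *)
Lemma nabla_inj (x y : nat -> R) : nabla x = nabla y -> x = y.
Proof.
intro H. apply functional_extensionality. induction x0 as [|n IH].
- rewrite <- (nabla_0 x), <- (nabla_0 y), H; reflexivity.
- assert (E : nabla x (S n) = nabla y (S n)) by (rewrite H; reflexivity).
  rewrite !nabla_S, IH in E. lra.
Qed.

Lemma iter_nabla_mull (i : nat) (x y : nat -> R) : iter_nabla i (x * y)%fps = (iter_nabla i x * y)%fps.
Proof.
induction i as [|i IH]; simpl; [reflexivity|].
rewrite IH. unfold nabla. ring.
Qed.

Lemma iter_nabla_mulr (i : nat) (x y : nat -> R) : iter_nabla i (x * y)%fps = (x * iter_nabla i y)%fps.
Proof.
induction i as [|i IH]; simpl; [reflexivity|].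
rewrite IH. unfold nabla. ring.
Qed.

Lemma iter_nabla_add (i : nat) (x y : nat -> R) : iter_nabla i (x + y)%fps = (iter_nabla i x + iter_nabla i y)%fps.
Proof.
induction i as [|i IH]; simpl; [reflexivity|].
rewrite IH. unfold nabla. ring.
Qed.

Lemma iter_nabla_nabla (i : nat) (x : nat -> R) : iter_nabla i (nabla x) = iter_nabla (S i) x.
Proof. rewrite Nat.iter_succ_r. reflexivity. Qed.

(* The Euler operator [z d/dz]. *)
Definition theta (x : nat -> R) (n : nat) : R := INR n * x n.

Lemma conv_sum (n : nat) : forall x y : nat -> R,
  (x * y)%fps n = sum_f_R0 (fun k => x k * y (n - k)%nat) n.
Proof.
induction n as [|n IH]; intros x y; [reflexivity|].
rewrite decomp_sum by lia. simpl. rewrite IH. reflexivity.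
Qed.

Lemma theta_mul (x y : nat -> R) : theta (x * y)%fps = (theta x * y + x * theta y)%fps.
Proof.
apply functional_extensionality; intro n. unfold theta, fadd.
rewrite !conv_sum, scal_sum, <- sum_plus. apply sum_eq. intros k Hk.
rewrite minus_INR by lia. ring.
Qed.

Lemma theta_nabla (x : nat -> R) : theta (nabla x) = (nabla (theta x) - delta 1 * x)%fps.
Proof.
unfold nabla. rewrite theta_mul.
replace (theta eps) with (- delta 1)%fps; [ring|].
apply functional_extensionality; intro n.
unfold theta, fopp, eps, fsub, f1, cst, delta.
destruct n as [|[|n]]; simpl; try ring.
Qed.

(** * Symbol estimates *)

(** Stand-in for [ln n] in all estimates: it is increasing and at least 1 from index 0 on, so the
    weights are positive everywhere and no small index is exceptional. *)
Definition harm (n : nat) : R := sum_f_R0 (fun k => / (INR k + 1)) n.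

Lemma INR1_pos (n : nat) : 0 < INR n + 1.
Proof. pose proof (pos_INR n); lra. Qed.

Lemma harm_S (n : nat) : harm (S n) = harm n + / (INR n + 2).
Proof. unfold harm; rewrite tech5, S_INR. do 2 f_equal. ring. Qed.

Lemma harm_mono (m n : nat) : (m <= n)%nat -> harm m <= harm n.
Proof.
induction 1 as [|n _ IH]; [lra|].
rewrite harm_S. pose proof (pos_INR n).
assert (0 < / (INR n + 2)) by (apply Rinv_0_lt_compat; lra). lra.
Qed.

Lemma harm_ge1 (n : nat) : 1 <= harm n.
Proof.
replace 1 with (harm 0) by (unfold harm; simpl; field).
apply harm_mono; lia.
Qed.

Lemma harm_le (n : nat) : harm n <= INR n + 1.
Proof.
induction n as [|n IH]; [unfold harm; simpl; lra|].
rewrite harm_S, S_INR. pose proof (pos_INR n).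
assert (/ (INR n + 2) <= / 1) by (apply Rinv_le_contravar; lra). lra.
Qed.

Definition weight (s p n : nat) : R := harm n ^ p / (INR n + 1) ^ s.

Lemma weight_pos (s p n : nat) : 0 < weight s p n.
Proof.
pose proof (harm_ge1 n); pose proof (INR1_pos n).
apply Rdiv_lt_0_compat; apply pow_lt; lra.
Qed.

Lemma weight_add_s (s i p n : nat) :
  weight (s + i) p n = weight s p n * (/ (INR n + 1)) ^ i.
Proof.
pose proof (INR1_pos n). unfold weight.
rewrite pow_add, pow_inv. field. split; apply pow_nonzero; lra.
Qed.

Lemma weight_le (s s' p p' n : nat) : (s' <= s)%nat -> (p <= p')%nat ->
  weight s p n <= weight s' p' n.
Proof.
intros Hs Hp. pose proof (harm_ge1 n); pose proof (INR1_pos n); pose proof (pos_INR n).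
unfold weight. apply Rmult_le_compat.
- apply pow_le; lra.
- left; apply Rinv_0_lt_compat, pow_lt; lra.
- apply Rle_pow; assumption.
- apply Rinv_le_contravar; [apply pow_lt; lra|]. apply Rle_pow; [lra|assumption].
Qed.

(** Indices comparable to [n] have comparable weights. The factor is 3 rather than 2 because of the
    cut in [symb_mul_gen]: for [n = 2] the window starts at index 0. *)
Lemma weight_doubling (s p k n : nat) :
  (k <= n)%nat -> INR n + 1 <= 3 * (INR k + 1) ->
  weight s p k <= 3 ^ s * weight s p n.
Proof.
intros Hk Hn. pose proof (harm_ge1 k); pose proof (INR1_pos n); pose proof (INR1_pos k).
unfold weight. replace (3 ^ s * (harm n ^ p / (INR n + 1) ^ s))
  with (harm n ^ p * / ((INR n + 1) / 3) ^ s).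
- apply Rmult_le_compat.
  + apply pow_le; lra.
  + left; apply Rinv_0_lt_compat, pow_lt; lra.
  + apply pow_incr; split; [lra|]. apply harm_mono; assumption.
  + apply Rinv_le_contravar; [apply pow_lt; lra|]. apply pow_incr; lra.
- unfold Rdiv at 1. rewrite Rpow_mult_distr, pow_inv. field.
  split; apply pow_nonzero; lra.
Qed.

Definition dominated (s p : nat) (x : nat -> R) : Prop :=
  exists K, 0 <= K /\ forall n, Rabs (x n) <= K * weight s p n.

(** The number [N] of controlled differences stays explicit: [Gs] is bounded in size only, each tail
    then adds one difference, and the regularity of [Vs] is gained step by step. *)
Definition symb (N s p : nat) (x : nat -> R) : Prop :=
  forall i, (i <= N)%nat -> dominated (s + i) p (iter_nabla i x).

(** The weight never vanishes, so the finitely many values before [n0] are absorbed into the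
    constant, one per induction step. *)
Lemma dominated_eventually (n0 s p : nat) (x : nat -> R) (K : R) :
  (forall n, (n0 <= n)%nat -> Rabs (x n) <= K * weight s p n) -> dominated s p x.
Proof.
revert K; induction n0 as [|m IH]; intros K H.
- exists (Rmax 0 K); split; [apply Rmax_l|]. intro n.
  eapply Rle_trans; [apply H; lia|].
  apply Rmult_le_compat_r; [left; apply weight_pos | apply Rmax_r].
- apply (IH (Rmax K (Rabs (x m) / weight s p m))). intros n Hn.
  pose proof (weight_pos s p n) as Hw.
  destruct (Nat.eq_dec n m) as [->|Hne].
  + replace (Rabs (x m)) with (Rabs (x m) / weight s p m * weight s p m) at 1
      by (field; lra).
    apply Rmult_le_compat_r; [lra | apply Rmax_r].
  + eapply Rle_trans; [apply H; lia|].
    apply Rmult_le_compat_r; [lra | apply Rmax_l].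
Qed.

Lemma dominated_le (s s' p p' : nat) (x : nat -> R) :
  (s' <= s)%nat -> (p <= p')%nat -> dominated s p x -> dominated s' p' x.
Proof.
intros Hs Hp [K [HK H]]. exists K; split; [assumption|]. intro n.
eapply Rle_trans; [apply H|]. apply Rmult_le_compat_l; [assumption|].
apply weight_le; assumption.
Qed.

Lemma dominated_add (s p : nat) (x y : nat -> R) :
  dominated s p x -> dominated s p y -> dominated s p (x + y)%fps.
Proof.
intros [K [HK Hx]] [K' [HK' Hy]]. exists (K + K'); split; [lra|]. intro n.
unfold fadd. eapply Rle_trans; [apply Rabs_triang|].
rewrite Rmult_plus_distr_r. apply Rplus_le_compat; auto.
Qed.

Lemma dominated_cst (s p : nat) (c : R) (x : nat -> R) :
  dominated s p x -> dominated s p (cst c * x)%fps.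
Proof.
intros [K [HK H]]. exists (Rabs c * K); split.
- apply Rmult_le_pos; [apply Rabs_pos | assumption].
- intro n. rewrite conv_cst, Rabs_mult, Rmult_assoc.
  apply Rmult_le_compat_l; [apply Rabs_pos | apply H].
Qed.

Lemma dominated_shift (s p : nat) (x : nat -> R) :
  dominated s p x -> dominated s p (delta 1 * x)%fps.
Proof.
intros [K [HK H]]. exists (K * 3 ^ s); split.
- apply Rmult_le_pos; [assumption | apply pow_le; lra].
- intro n. rewrite conv_delta. destruct n as [|n]; simpl Nat.leb; cbv iota.
  + rewrite Rabs_R0. pose proof (weight_pos s p 0).
    apply Rmult_le_pos; [|lra]. apply Rmult_le_pos; [assumption | apply pow_le; lra].
  + replace (S n - 1)%nat with n by lia. eapply Rle_trans; [apply H|].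
    rewrite Rmult_assoc. apply Rmult_le_compat_l; [assumption|].
    apply weight_doubling; [lia|]. rewrite S_INR. pose proof (pos_INR n); lra.
Qed.

Lemma dominated_finite (n0 s p : nat) (x : nat -> R) :
  (forall n, (n0 <= n)%nat -> x n = 0) -> dominated s p x.
Proof.
intro H. apply (dominated_eventually n0 s p x 0). intros n Hn.
rewrite H by assumption. rewrite Rabs_R0. lra.
Qed.

Lemma symb_le (N N' s s' p p' : nat) (x : nat -> R) :
  (N' <= N)%nat -> (s' <= s)%nat -> (p <= p')%nat -> symb N s p x -> symb N' s' p' x.
Proof.
intros HN Hs Hp H i Hi. apply (dominated_le (s + i) (s' + i) p p'); try lia. apply H; lia.
Qed.

Lemma symb_add (N s p : nat) (x y : nat -> R) :
  symb N s p x -> symb N s p y -> symb N s p (x + y)%fps.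
Proof. intros Hx Hy i Hi. rewrite iter_nabla_add. apply dominated_add; auto. Qed.

Lemma symb_cst (N s p : nat) (c : R) (x : nat -> R) :
  symb N s p x -> symb N s p (cst c * x)%fps.
Proof. intros Hx i Hi. rewrite iter_nabla_mulr. apply dominated_cst; auto. Qed.

Lemma symb_nabla (N s p : nat) (x : nat -> R) :
  symb (S N) s p x -> symb N (S s) p (nabla x).
Proof.
intros Hx i Hi. rewrite iter_nabla_nabla. replace (S s + i)%nat with (s + S i)%nat by lia.
apply Hx; lia.
Qed.

Lemma symb_S (N s p : nat) (x : nat -> R) :
  dominated s p x -> symb N (S s) p (nabla x) -> symb (S N) s p x.
Proof.
intros H0 HD [|i] Hi.
- rewrite Nat.add_0_r. exact H0.
- rewrite <- iter_nabla_nabla. replace (s + S i)%nat with (S s + i)%nat by lia. apply HD; lia.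
Qed.

Lemma iter_nabla_finite (i : nat) : forall (n0 : nat) (x : nat -> R),
  (forall n, (n0 <= n)%nat -> x n = 0) ->
  forall n, (n0 + i <= n)%nat -> iter_nabla i x n = 0.
Proof.
induction i as [|i IH]; intros n0 x H n Hn; [apply H; lia|].
destruct n as [|n]; [lia|]. simpl. rewrite nabla_S.
rewrite !(IH n0) by (assumption || lia). ring.
Qed.

Lemma symb_finite (n0 N s p : nat) (x : nat -> R) :
  (forall n, (n0 <= n)%nat -> x n = 0) -> symb N s p x.
Proof.
intros H i _. apply (dominated_finite (n0 + i)). apply iter_nabla_finite; assumption.
Qed.

Lemma symb_const (N s p : nat) (c : R) : symb N s p (cst c).
Proof.
apply (symb_finite 1). intros [|n] Hn; [lia|]. unfold cst, delta; simpl; ring.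
Qed.

Lemma dominated_theta (s p : nat) (x : nat -> R) :
  dominated (S s) p x -> dominated s p (theta x).
Proof.
intros [K [HK H]]. exists K; split; [assumption|]. intro n.
unfold theta. rewrite Rabs_mult, (Rabs_pos_eq (INR n)) by apply pos_INR.
pose proof (INR1_pos n); pose proof (pos_INR n).
specialize (H n). replace (S s) with (s + 1)%nat in H by lia.
rewrite weight_add_s in H. pose proof (weight_pos s p n).
apply Rle_trans with ((INR n + 1) * (K * (weight s p n * (/ (INR n + 1)) ^ 1))).
- apply Rmult_le_compat; auto using Rabs_pos; lra.
- right. field. lra.
Qed.

Lemma dominated_theta_inv (s p : nat) (x : nat -> R) :
  dominated s p (theta x) -> dominated (S s) p x.
Proof.
(* [theta x] vanishes at 0 and says nothing about [x 0], so the estimate starts at index 1, where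
   [n + 1 <= 2 n] gives the factor 2. *)
intros [K [HK H]]. apply (dominated_eventually 1 _ _ _ (2 * K)). intros n Hn.
assert (Hn' : 1 <= INR n) by (apply (le_INR 1); assumption).
specialize (H n). unfold theta in H.
rewrite Rabs_mult, (Rabs_pos_eq (INR n)) in H by lra.
replace (S s) with (s + 1)%nat by lia. rewrite weight_add_s.
pose proof (weight_pos s p n).
replace (2 * K * (weight s p n * (/ (INR n + 1)) ^ 1))
  with (2 * / (INR n + 1) * (K * weight s p n)) by (field; lra).
assert (Hi : / INR n <= 2 * / (INR n + 1)).
{ apply Rmult_le_reg_l with (INR n * (INR n + 1)); [nra|].
  replace (INR n * (INR n + 1) * / INR n) with (INR n + 1) by (field; lra).
  replace (INR n * (INR n + 1) * (2 * / (INR n + 1))) with (2 * INR n) by (field; lra).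
  lra. }
replace (Rabs (x n)) with (/ INR n * (INR n * Rabs (x n))) by (field; lra).
apply Rmult_le_compat; auto.
- left; apply Rinv_0_lt_compat; lra.
- apply Rmult_le_pos; [lra | apply Rabs_pos].
Qed.

(** Leibniz rule for [(1 - z)^(i+1) x]: the operator [z d/dz] sends [(1 - z)^(i+1)] to
    [- (i+1) z (1 - z)^i]. *)
Lemma theta_iter_nabla (i : nat) (x : nat -> R) :
  theta (iter_nabla (S i) x) = (iter_nabla (S i) (theta x) + cst (- INR (S i)) * (delta 1 * iter_nabla i x))%fps.
Proof.
assert (C : forall c, cst (- c) = (- cst c)%fps).
{ intro c. apply functional_extensionality; intro n. unfold cst, fopp; ring. }
induction i as [|i IH].
- simpl Nat.iter. rewrite theta_nabla, C. simpl INR. change (cst 1) with f1. ring.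
- change (iter_nabla (S (S i)) x) with (nabla (iter_nabla (S i) x)). rewrite theta_nabla, IH.
  change (iter_nabla (S (S i)) (theta x)) with (nabla (iter_nabla (S i) (theta x))).
  rewrite (S_INR (S i)).
  replace (cst (- (INR (S i) + 1))) with (cst (- INR (S i)) - f1)%fps
    by (apply functional_extensionality; intro n; unfold fsub, f1, cst; ring).
  change (iter_nabla (S i) x) with (nabla (iter_nabla i x)). unfold nabla. ring.
Qed.

(** By the commutation rule, [n] times a difference of [x] is a difference of [theta x] plus a
    shifted difference of [x] of one order less, which the induction has already bounded. *)
Lemma symb_theta_inv (N s p : nat) (x : nat -> R) :
  symb N s p (theta x) -> symb N (S s) p x.
Proof.
intros H i. induction i as [|i IH]; intro Hi.
- rewrite Nat.add_0_r. apply dominated_theta_inv.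
  rewrite <- (Nat.add_0_r s). apply (H 0%nat); lia.
- change (S s + S i)%nat with (S (s + S i)).
  apply dominated_theta_inv. rewrite theta_iter_nabla. apply dominated_add; [apply H; lia|].
  apply dominated_cst, dominated_shift.
  replace (s + S i)%nat with (S s + i)%nat by lia. apply IH; lia.
Qed.

Lemma symb_theta (N s p : nat) (x : nat -> R) :
  symb N (S s) p x -> symb N s p (theta x).
Proof.
intros H [|i] Hi.
- rewrite Nat.add_0_r. apply dominated_theta. rewrite <- (Nat.add_0_r (S s)).
  apply (H 0%nat); lia.
- replace (iter_nabla (S i) (theta x))
    with (theta (iter_nabla (S i) x) + cst (INR (S i)) * (delta 1 * iter_nabla i x))%fps.
  + apply dominated_add.
    * apply dominated_theta. apply (H (S i)); lia.
    * apply dominated_cst, dominated_shift.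
      replace (s + S i)%nat with (S s + i)%nat by lia. apply H; lia.
  + rewrite theta_iter_nabla.
    replace (cst (- INR (S i))) with (- cst (INR (S i)))%fps
      by (apply functional_extensionality; intro n; unfold cst, fopp; ring).
    ring.
Qed.

(** * Products of symbols: cutting a convolution in the middle *)

Definition lo (m : nat) (x : nat -> R) (n : nat) : R := if Nat.leb n m then x n else 0.
Definition hi (m : nat) (x : nat -> R) (n : nat) : R := if Nat.leb n m then 0 else x n.

Lemma lo_hi (m : nat) (x : nat -> R) : x = (lo m x + hi m x)%fps.
Proof.
apply functional_extensionality; intro n. unfold fadd, lo, hi.
destruct (Nat.leb n m); ring.
Qed.

(** The truncated sequence jumps by [x (S m)] at the cut; [nabla x (S m)] accounts for all of it but
    [x m]. *)
Lemma nabla_hi (m : nat) (x : nat -> R) :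
  nabla (hi m x) = (hi m (nabla x) + cst (x m) * delta (S m))%fps.
Proof.
apply functional_extensionality; intros [|n].
- rewrite nabla_0. unfold fadd. rewrite conv_cst. unfold hi, delta; simpl. ring.
- rewrite nabla_S. unfold fadd. rewrite conv_cst. unfold hi. rewrite nabla_S.
  unfold delta. change (Nat.eqb (S m) (S n)) with (Nat.eqb m n).
  destruct (Nat.leb_spec (S n) m), (Nat.leb_spec n m), (Nat.eqb_spec m n); try lia; subst; ring.
Qed.

Lemma conv_abs_le (x y : nat -> R) (n : nat) :
  Rabs ((x * y)%fps n) <= sum_f_R0 (fun k => Rabs (x k) * Rabs (y (n - k)%nat)) n.
Proof.
rewrite conv_sum. eapply Rle_trans; [apply Rabs_triang_gen|].
right. apply sum_eq. intros; apply Rabs_mult.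
Qed.

Lemma lo_bound (m n : nat) (x y : nat -> R) (B : R) : (m <= n)%nat ->
  0 <= B -> (forall j, (n - m <= j <= n)%nat -> Rabs (y j) <= B) ->
  Rabs ((lo m x * y)%fps n) <= B * sum_f_R0 (fun k => Rabs (x k)) n.
Proof.
intros Hm HB Hy. eapply Rle_trans; [apply conv_abs_le|].
rewrite scal_sum. apply sum_Rle. intros k Hk. unfold lo.
destruct (Nat.leb_spec k m).
- apply Rmult_le_compat_l; [apply Rabs_pos|]. apply Hy; lia.
- rewrite Rabs_R0, Rmult_0_l. apply Rmult_le_pos; [apply Rabs_pos | assumption].
Qed.

Lemma hi_bound (m n : nat) (x y : nat -> R) (A : R) :
  0 <= A -> (forall k, (m <= k <= n)%nat -> Rabs (x k) <= A) ->
  Rabs ((hi m x * y)%fps n) <= A * sum_f_R0 (fun k => Rabs (y k)) n.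
Proof.
intros HA Hx. rewrite conv_sym. eapply Rle_trans; [apply conv_abs_le|].
rewrite scal_sum. apply sum_Rle. intros k Hk.
apply Rmult_le_compat_l; [apply Rabs_pos|]. unfold hi.
destruct (Nat.leb_spec (n - k) m).
- rewrite Rabs_R0; assumption.
- apply Hx; lia.
Qed.

(* Differencing the upper half of the convolution produces, besides the
   convolution with the differences, one boundary term at the cut per step. *)
Lemma iter_nabla_hi_bound (m n : nat) (y : nat -> R) (B r rho : R) :
  (m < n)%nat -> 0 <= B -> 0 < r -> r * rho = 1 ->
  forall (N : nat) (x : nat -> R) (A : R), 0 <= A ->
  (forall i k, (i <= N)%nat -> (m <= k <= n)%nat -> Rabs (iter_nabla i x k) <= A * r ^ i) ->
  (forall i, (i < N)%nat -> Rabs (iter_nabla i y (n - S m)%nat) <= B * r ^ i) ->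
  Rabs (iter_nabla N (hi m x * y)%fps n)
    <= r ^ N * (A * sum_f_R0 (fun k => Rabs (y k)) n + INR N * (A * B * rho)).
Proof.
intros Hm HB Hr Hrho N. induction N as [|N IH]; intros x A HA Hx Hy.
- simpl. eapply Rle_trans.
  + apply (hi_bound m n x y A HA). intros k Hk. specialize (Hx 0%nat k (le_n _) Hk).
    simpl in Hx; lra.
  + right; ring.
- rewrite <- iter_nabla_nabla.
  replace (nabla (hi m x * y)%fps)
    with (hi m (nabla x) * y + cst (x m) * (delta (S m) * y))%fps.
  2:{ change (nabla (hi m x * y)%fps) with (iter_nabla 1 (hi m x * y)%fps).
      rewrite iter_nabla_mull. simpl Nat.iter. rewrite nabla_hi. ring. }
  rewrite iter_nabla_add, !iter_nabla_mulr. unfold fadd at 1. rewrite conv_cst, conv_delta.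
  destruct (Nat.leb_spec (S m) n) as [_|]; [|lia].
  eapply Rle_trans; [apply Rabs_triang|].
  replace (hi m (nabla x) * iter_nabla N y)%fps with (iter_nabla N (hi m (nabla x) * y)%fps) by apply iter_nabla_mulr.
  assert (H1 := IH (nabla x) (A * r) ltac:(nra)).
  assert (H2 : Rabs (x m * iter_nabla N y (n - S m)%nat) <= A * (B * r ^ N)).
  { rewrite Rabs_mult. apply Rmult_le_compat; try apply Rabs_pos.
    - specialize (Hx 0%nat m ltac:(lia) ltac:(lia)). simpl in Hx; lra.
    - apply Hy; lia. }
  eapply Rle_trans.
  + apply Rplus_le_compat; [apply H1 | apply H2].
    * intros i k Hi Hk. rewrite iter_nabla_nabla. specialize (Hx (S i) k ltac:(lia) Hk).
      simpl pow in Hx. rewrite Rmult_assoc. exact Hx.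
    * intros i Hi. apply Hy; lia.
  (* The boundary term has one factor [r] too few; it is supplied by [r * rho = 1], whence the [rho]
     in the bound. *)
  + right. rewrite S_INR. simpl pow.
    replace (A * (B * r ^ N)) with (A * (B * r ^ N) * (r * rho)) by (rewrite Hrho; ring).
    ring.
Qed.

Lemma symb_uniform (N s p : nat) (x : nat -> R) : symb N s p x ->
  exists K, 0 <= K /\ forall i n, (i <= N)%nat ->
    Rabs (iter_nabla i x n) <= K * weight (s + i) p n.
Proof.
induction N as [|N IH]; intro H.
- destruct (H 0%nat (le_n _)) as [K [HK Hb]]. exists K; split; [assumption|].
  intros i n Hi. replace i with 0%nat by lia. apply Hb.
- destruct IH as [K [HK Hb]]; [intros i Hi; apply H; lia|].
  destruct (H (S N) (le_n _)) as [K' [HK' Hb']].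
  exists (K + K'); split; [lra|]. intros i n Hi.
  pose proof (weight_pos (s + i) p n).
  destruct (Nat.eq_dec i (S N)) as [->|Hne].
  + specialize (Hb' n). nra.
  + specialize (Hb i n ltac:(lia)). nra.
Qed.

Lemma symb_local (N s p m n : nat) (x : nat -> R) (K : R) : 0 <= K ->
  (forall i n, (i <= N)%nat -> Rabs (iter_nabla i x n) <= K * weight (s + i) p n) ->
  forall i k, (i <= N)%nat -> (m <= k <= n)%nat -> INR n + 1 <= 3 * (INR m + 1) ->
  Rabs (iter_nabla i x k) <= K * 3 ^ (s + N) * weight s p n * (/ (INR n + 1)) ^ i.
Proof.
intros HK H i k Hi Hk Hm.
eapply Rle_trans; [apply H; assumption|].
rewrite !Rmult_assoc, <- weight_add_s. apply Rmult_le_compat_l; [assumption|].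
eapply Rle_trans.
- apply (weight_doubling (s + i) p k n); [lia|].
  assert (INR m <= INR k) by (apply le_INR; lia). lra.
- apply Rmult_le_compat_r; [left; apply weight_pos|]. apply Rle_pow; [lra|lia].
Qed.

(** In each half of the convolution the differences are put on the factor whose index is comparable
    to [n], and the other factor is summed in absolute value. The three inequalities on weights
    serve, in this order, the lower half, the upper half and the boundary terms at the cut. *)
Lemma symb_mul_gen (N s p s' p' s'' p'' : nat) (x y : nat -> R) :
  symb N s p x -> symb N s' p' y ->
  (exists K, 0 <= K /\ forall n,
     weight s' p' n * sum_f_R0 (weight s p) n <= K * weight s'' p'' n /\
     weight s p n * sum_f_R0 (weight s' p') n <= K * weight s'' p'' n /\
     weight s p n * weight s' p' n * (INR n + 1) <= K * weight s'' p'' n) ->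
  symb N s'' p'' (x * y)%fps.
Proof.
intros Hx Hy [K [HK HW]] M HM.
assert (Hx' : symb M s p x) by (intros i Hi; apply Hx; lia).
assert (Hy' : symb M s' p' y) by (intros i Hi; apply Hy; lia).
destruct (symb_uniform _ _ _ _ Hx') as [Kx [HKx Bx]].
destruct (symb_uniform _ _ _ _ Hy') as [Ky [HKy By]].
set (Cx := Kx * 3 ^ (s + M)). set (Cy := Ky * 3 ^ (s' + M)).
assert (HCx : 0 <= Cx) by (apply Rmult_le_pos; [|apply pow_le]; lra).
assert (HCy : 0 <= Cy) by (apply Rmult_le_pos; [|apply pow_le]; lra).
apply (dominated_eventually 1 _ _ _ ((Cy * Kx + Cx * Ky + INR M * (Cx * Cy)) * K)).
(* Both [m] and [n - S m] are then comparable to [n] in the sense of [weight_doubling]; the second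
   one needs [n >= 1]. *)
intros n Hn. set (m := Nat.div2 n).
assert (Hdiv : (n <= 2 * m + 1 /\ 2 * m <= n)%nat).
{ unfold m. pose proof (Nat.div2_odd n). destruct (Nat.odd n); simpl Nat.b2n in *; lia. }
assert (Hmn : (m < n)%nat) by lia.
assert (H1 : INR n + 1 <= 3 * (INR m + 1)).
{ assert (H := le_INR n (2 * m + 1) ltac:(lia)).
  rewrite plus_INR, mult_INR in H. simpl in H. pose proof (pos_INR m). lra. }
assert (H2 : INR n + 1 <= 3 * (INR (n - S m) + 1)).
{ assert (H := le_INR (n + 1) (3 * (n - S m + 1)) ltac:(lia)).
  rewrite mult_INR, !plus_INR in H. simpl in H. lra. }
pose proof (weight_pos s p n) as Wx. pose proof (weight_pos s' p' n) as Wy.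
pose proof (INR1_pos n) as Hn1.
assert (Hr : 0 < / (INR n + 1)) by (apply Rinv_0_lt_compat; assumption).
assert (Sx : sum_f_R0 (fun k => Rabs (x k)) n <= Kx * sum_f_R0 (weight s p) n).
{ rewrite scal_sum. apply sum_Rle. intros k _. specialize (Bx 0%nat k ltac:(lia)).
  rewrite Nat.add_0_r in Bx. simpl in Bx; lra. }
assert (Sy : sum_f_R0 (fun k => Rabs (y k)) n <= Ky * sum_f_R0 (weight s' p') n).
{ rewrite scal_sum. apply sum_Rle. intros k _. specialize (By 0%nat k ltac:(lia)).
  rewrite Nat.add_0_r in By. simpl in By; lra. }
rewrite (lo_hi m x).
replace ((lo m x + hi m x) * y)%fps with (lo m x * y + hi m x * y)%fps by ring.
rewrite iter_nabla_add. unfold fadd. eapply Rle_trans; [apply Rabs_triang|].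
assert (Hlo : Rabs (iter_nabla M (lo m x * y)%fps n) <=
   Cy * weight s' p' n * (/ (INR n + 1)) ^ M * sum_f_R0 (fun k => Rabs (x k)) n).
{ rewrite iter_nabla_mulr. apply lo_bound; [lia| |].
  - apply Rmult_le_pos; [nra|]. apply pow_le; lra.
  - intros j Hj. unfold Cy. apply (symb_local M s' p' (n - S m) n); try assumption; lia. }
assert (Hhi := iter_nabla_hi_bound m n y (Cy * weight s' p' n) (/ (INR n + 1)) (INR n + 1)
  Hmn ltac:(nra) Hr ltac:(field; lra) M x (Cx * weight s p n) ltac:(nra)
  (fun i k Hi Hk => symb_local M s p m n x Kx HKx Bx i k Hi Hk H1)
  (fun i Hi => symb_local M s' p' (n - S m) n y Ky HKy By i (n - S m)
     ltac:(lia) ltac:(lia) H2)).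
rewrite weight_add_s.
destruct (HW n) as [W1 [W2 W3]].
set (rM := (/ (INR n + 1)) ^ M) in *.
assert (HrM : 0 < rM) by (apply pow_lt; assumption).
pose proof (pos_INR M) as HM0.
set (wx := weight s p n) in *. set (wy := weight s' p' n) in *.
set (w := weight s'' p'' n) in *.
set (X := sum_f_R0 (weight s p) n) in *. set (Y := sum_f_R0 (weight s' p') n) in *.
eapply Rle_trans; [apply Rplus_le_compat; [apply Hlo | apply Hhi]|].
apply Rle_trans with
  (rM * (Cy * Kx * (wy * X) + Cx * Ky * (wx * Y)
         + INR M * (Cx * Cy) * (wx * wy * (INR n + 1)))).
- apply Rle_trans with (rM * (Cy * wy * (Kx * X) + (Cx * wx * (Ky * Y)
         + INR M * (Cx * wx * (Cy * wy) * (INR n + 1))))).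
  + rewrite (Rmult_comm (Cy * wy) rM), Rmult_assoc, <- Rmult_plus_distr_l.
    apply Rmult_le_compat_l; [lra|].
    apply Rplus_le_compat; [|apply Rplus_le_compat_r];
      (apply Rmult_le_compat_l; [nra|assumption]).
  + right; ring.
- replace ((Cy * Kx + Cx * Ky + INR M * (Cx * Cy)) * K * (w * rM))
    with (rM * (Cy * Kx * (K * w) + Cx * Ky * (K * w) + INR M * (Cx * Cy) * (K * w)))
    by ring.
  apply Rmult_le_compat_l; [lra|].
  assert (0 <= Cy * Kx) by nra. assert (0 <= Cx * Ky) by nra.
  assert (0 <= INR M * (Cx * Cy)) by (apply Rmult_le_pos; nra).
  repeat apply Rplus_le_compat; apply Rmult_le_compat_l; assumption.
Qed.

Lemma sum_weight1 (p n : nat) : sum_f_R0 (weight 1 p) n <= harm n ^ S p.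
Proof.
apply Rle_trans with (harm n ^ p * harm n); [|right; simpl; ring].
unfold harm at 2. rewrite scal_sum. apply sum_Rle. intros k Hk.
unfold weight. rewrite pow_1. unfold Rdiv. rewrite (Rmult_comm (harm k ^ p)).
pose proof (INR1_pos k). apply Rmult_le_compat_l.
- left; apply Rinv_0_lt_compat; assumption.
- pose proof (harm_ge1 k). apply pow_incr. split; [lra|]. apply harm_mono; assumption.
Qed.

Lemma sum_weight2 (n : nat) : sum_f_R0 (weight 2 0) n <= 2.
Proof.
enough (H : sum_f_R0 (weight 2 0) n <= 2 - / (INR n + 1)).
{ pose proof (INR1_pos n). assert (0 < / (INR n + 1)) by (apply Rinv_0_lt_compat; lra). lra. }
induction n as [|n IH].
- unfold weight; simpl. lra.
- rewrite tech5. unfold weight at 2. rewrite pow_O, S_INR.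
  pose proof (pos_INR n).
  assert (1 / (INR n + 1 + 1) ^ 2 <= / (INR n + 1) - / (INR n + 1 + 1)); [|lra].
  apply Rminus_le_0.
  replace (_ - _) with (/ ((INR n + 1) * (INR n + 1 + 1) ^ 2)) by (field; lra).
  left; apply Rinv_0_lt_compat. apply Rmult_lt_0_compat; [lra|]. apply pow_lt; lra.
Qed.

(** The partial sums of a sequence of order 1 contribute one more harmonic factor; this is where the
    logarithms come from. *)
Lemma symb_mul_11 (N p q : nat) (x y : nat -> R) :
  symb N 1 p x -> symb N 1 q y -> symb N 1 (p + q + 1) (x * y)%fps.
Proof.
intros Hx Hy. apply (symb_mul_gen N 1 p 1 q); [assumption..|].
exists 1; split; [lra|]. intro n. pose proof (INR1_pos n). pose proof (harm_ge1 n).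
assert (G : forall a b, weight 1 a n * harm n ^ S b = weight 1 (a + b + 1) n).
{ intros a b. unfold weight. rewrite !pow_add. simpl. field. lra. }
repeat split.
- eapply Rle_trans; [apply Rmult_le_compat_l; [left; apply weight_pos | apply sum_weight1]|].
  rewrite G. replace (q + p + 1)%nat with (p + q + 1)%nat by lia. lra.
- eapply Rle_trans; [apply Rmult_le_compat_l; [left; apply weight_pos | apply sum_weight1]|].
  rewrite G. lra.
- apply Rle_trans with (weight 1 (p + q) n).
  + right. unfold weight. rewrite !pow_add. field. lra.
  + rewrite Rmult_1_l. apply weight_le; lia.
Qed.

Lemma symb_mul_22 (N : nat) (x y : nat -> R) :
  symb N 2 0 x -> symb N 2 0 y -> symb N 2 0 (x * y)%fps.
Proof.
intros Hx Hy. apply (symb_mul_gen N 2 0 2 0); [assumption..|].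
exists 2; split; [lra|]. intro n. pose proof (INR1_pos n).
pose proof (weight_pos 2 0 n). pose proof (sum_weight2 n).
repeat split; try nra.
rewrite Rmult_assoc, Rmult_comm. apply Rmult_le_compat_r; [lra|].
apply Rle_trans with (weight 1 0 n).
- right. unfold weight. field. lra.
- apply Rle_trans with (weight 0 0 n); [apply weight_le; lia|]. unfold weight; simpl; lra.
Qed.

(** The order-2 factor is summable. The extra logarithm from summing the order-1 factor is
    multiplied by [1/(n+1)^2] and absorbed by [harm n <= n + 1]. *)
Lemma symb_mul_12 (N p : nat) (x y : nat -> R) :
  symb N 1 p x -> symb N 2 0 y -> symb N 1 p (x * y)%fps.
Proof.
intros Hx Hy. apply (symb_mul_gen N 1 p 2 0); [assumption..|].
exists 2; split; [lra|]. intro n. pose proof (INR1_pos n). pose proof (harm_ge1 n).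
pose proof (weight_pos 2 0 n). pose proof (weight_pos 1 p n). pose proof (sum_weight2 n).
repeat split; try nra.
- apply Rle_trans with (weight 2 0 n * harm n ^ S p).
  { apply Rmult_le_compat_l; [lra | apply sum_weight1]. }
  apply Rle_trans with (weight 1 p n * (harm n / (INR n + 1))).
  { right; unfold weight; simpl; field; lra. }
  rewrite Rmult_comm. apply Rmult_le_compat_r; [lra|].
  apply Rle_trans with 1; [|lra]. apply Rmult_le_reg_r with (INR n + 1); [lra|].
  unfold Rdiv. rewrite Rmult_assoc, Rinv_l by lra. pose proof (harm_le n). lra.
- apply Rle_trans with (weight 2 p n).
  + right. unfold weight; simpl; field; lra.
  + apply Rle_trans with (weight 1 p n); [apply weight_le; lia | lra].
Qed.

(** * Tails of series *)

Lemma is_series_telescope (u : nat -> R) :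
  is_lim_seq u 0 -> is_series (fun j => u j - u (S j)) (u O).
Proof.
intro H. change (is_lim_seq (sum_n (fun j => u j - u (S j))) (u O)).
apply (is_lim_seq_ext (fun n => u O - u (S n))).
- intro n. induction n as [|n IH].
  + rewrite sum_O. reflexivity.
  + rewrite sum_Sn, <- IH. unfold plus; simpl. ring.
- replace (Finite (u O)) with (Rbar_minus (u O) 0) by (simpl; f_equal; ring).
  apply (is_lim_seq_minus' _ _ (u O) 0).
  + apply is_lim_seq_const.
  + apply is_lim_seq_incr_1 in H. exact H.
Qed.

Lemma is_lim_seq_inv_shift (c : nat) : is_lim_seq (fun j => / (INR (c + j) + 1)) 0.
Proof.
apply (is_lim_seq_ext (fun j => / INR (j + S c))).
- intro j. rewrite <- S_INR. do 2 f_equal. lia.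
- apply (is_lim_seq_incr_n (fun j => / INR j) (S c)).
  replace (Finite 0) with (Rbar_inv p_infty) by reflexivity.
  apply is_lim_seq_inv; [apply is_lim_seq_INR | discriminate].
Qed.

(** Coefficients of [(x(1) - x(z)) / (1 - z)], as [nabla_tail] confirms: the sum starts strictly
    after [n]. *)
Definition tail (x : nat -> R) (n : nat) : R := Series (fun k => x (n + S k)%nat).

Lemma is_series_inv_gap (n : nat) :
  is_series (fun j => / (INR (n + j) + 1) - / (INR (n + S j) + 1)) (/ (INR n + 1)).
Proof.
assert (H := is_series_telescope _ (is_lim_seq_inv_shift n)). simpl in H.
rewrite Nat.add_0_r in H. exact H.
Qed.

(** Two of the powers are used for the telescoping bound [1/(k+1)^2 <= 1/k - 1/(k+1)]; the others
    are estimated at the start of the tail. *)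
Lemma weight_gap (s n j : nat) :
  weight (S (S s)) 0 (n + S j)
  <= (/ (INR (n + j) + 1) - / (INR (n + S j) + 1)) * (/ (INR n + 1)) ^ s.
Proof.
pose proof (INR1_pos n) as Hn. pose proof (INR1_pos (n + j)) as Hj.
replace (S (S s)) with (2 + s)%nat by lia. rewrite weight_add_s.
assert (Hle : INR n <= INR (n + S j)) by (apply le_INR; lia).
apply Rmult_le_compat.
- left; apply weight_pos.
- apply pow_le; left; apply Rinv_0_lt_compat; lra.
- unfold weight. replace (n + S j)%nat with (S (n + j)) by lia.
  rewrite S_INR. apply Rminus_le_0. set (u := INR (n + j)) in *.
  replace (_ - _) with (/ ((u + 1) * (u + 1 + 1) ^ 2)) by (field; lra).
  left; apply Rinv_0_lt_compat, Rmult_lt_0_compat; [lra|]. apply pow_lt; lra.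
- apply pow_incr; split.
  + left; apply Rinv_0_lt_compat; lra.
  + apply Rinv_le_contravar; lra.
Qed.

Lemma dominated_tail_gap (s : nat) (x : nat -> R) : dominated (S (S s)) 0 x ->
  exists K, 0 <= K /\ forall n j, Rabs (x (n + S j)%nat)
    <= K * (/ (INR n + 1)) ^ s * (/ (INR (n + j) + 1) - / (INR (n + S j) + 1)).
Proof.
intros [K [HK H]]. exists K; split; [assumption|]. intros n j.
eapply Rle_trans; [apply H|]. rewrite Rmult_assoc. apply Rmult_le_compat_l; [assumption|].
rewrite Rmult_comm. apply weight_gap.
Qed.

Lemma dominated_ex_series_tail (x : nat -> R) (n : nat) : dominated 2 0 x ->
  ex_series (fun j => Rabs (x (n + S j)%nat)).
Proof.
intro H. destruct (dominated_tail_gap 0 x H) as [K [HK Hx]].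
apply (@ex_series_le R_AbsRing R_CompleteNormedModule) with
  (b := fun j => K * (/ (INR n + 1)) ^ 0 * (/ (INR (n + j) + 1) - / (INR (n + S j) + 1))).
- intro j. change (norm (Rabs (x (n + S j)%nat))) with (Rabs (Rabs (x (n + S j)%nat))).
  rewrite Rabs_Rabsolu. apply Hx.
- exists (K * (/ (INR n + 1)) ^ 0 * / (INR n + 1)). apply (is_series_scal_l _ _ _ (is_series_inv_gap n)).
Qed.

Lemma dominated_ex_series_abs (x : nat -> R) : dominated 2 0 x -> ex_series (fun n => Rabs (x n)).
Proof.
intro H. apply ex_series_incr_1. apply (dominated_ex_series_tail x 0 H).
Qed.

Lemma dominated_ex_series (x : nat -> R) : dominated 2 0 x -> ex_series x.
Proof. intro H. apply ex_series_Rabs, dominated_ex_series_abs, H. Qed.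

Lemma dominated_tail (s : nat) (x : nat -> R) :
  dominated (S (S s)) 0 x -> dominated (S s) 0 (tail x).
Proof.
intro H. destruct (dominated_tail_gap s x H) as [K [HK Hx]].
exists K; split; [assumption|]. intro n. unfold tail.
eapply Rle_trans; [apply Series_Rabs, dominated_ex_series_tail|].
- apply (dominated_le (S (S s)) 2 0 0); try lia; assumption.
- assert (G : is_series (fun j => K * (/ (INR n + 1)) ^ s
      * (/ (INR (n + j) + 1) - / (INR (n + S j) + 1)))
      (K * (/ (INR n + 1)) ^ s * / (INR n + 1)))
    by apply (is_series_scal_l _ _ _ (is_series_inv_gap n)).
  eapply Rle_trans; [apply Series_le with (2 := ex_intro _ _ G)|].
  + intro j. split; [apply Rabs_pos | apply Hx].
  + rewrite (is_series_unique _ _ G). right.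
    replace (S s) with (1 + s)%nat by lia. rewrite weight_add_s. unfold weight.
    simpl. field. apply Rgt_not_eq, INR1_pos.
Qed.

Lemma tail_step (x : nat -> R) (n : nat) : ex_series x -> tail x n = x (S n) + tail x (S n).
Proof.
intro H. unfold tail. rewrite Series_incr_1.
- f_equal; [f_equal; lia|]. apply Series_ext. intro k. f_equal; lia.
- apply (ex_series_incr_n x (S n)) in H. revert H. apply ex_series_ext.
  intro k. f_equal; lia.
Qed.

Lemma nabla_tail (x : nat -> R) : ex_series x -> nabla (tail x) = (cst (Series x) - x)%fps.
Proof.
intro H. apply functional_extensionality; intros [|n].
- rewrite nabla_0. unfold fsub, cst, delta; simpl. rewrite Series_incr_1 by assumption.
  unfold tail. simpl. ring.
- rewrite nabla_S, (tail_step x n) by assumption. unfold fsub, cst, delta; simpl. ring.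
Qed.

Lemma symb_opp (N s p : nat) (x : nat -> R) : symb N s p x -> symb N s p (- x)%fps.
Proof.
intro H. replace (- x)%fps with (cst (-1) * x)%fps; [apply symb_cst, H|].
apply functional_extensionality; intro n. rewrite conv_cst. unfold fopp; ring.
Qed.

Lemma symb_sub (N s p : nat) (x y : nat -> R) :
  symb N s p x -> symb N s p y -> symb N s p (x - y)%fps.
Proof.
intros Hx Hy. replace (x - y)%fps with (x + - y)%fps by ring.
apply symb_add; [|apply symb_opp]; assumption.
Qed.

Lemma symb_dominated (N s p : nat) (x : nat -> R) : symb N s p x -> dominated s p x.
Proof. intro H. rewrite <- (Nat.add_0_r s). apply (H 0%nat); lia. Qed.

(** One power of [n] is lost and one difference gained, since differencing the tail gives back [- x]
    except at index 0. *)
Lemma symb_tail (N s : nat) (x : nat -> R) :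
  symb N (S (S s)) 0 x -> symb (S N) (S s) 0 (tail x).
Proof.
intro H. assert (H0 := symb_dominated _ _ _ _ H). apply symb_S.
- apply dominated_tail; assumption.
- rewrite nabla_tail.
  + apply symb_sub; [apply symb_const | assumption].
  + apply dominated_ex_series, (dominated_le (S (S s)) 2 0 0); try lia; assumption.
Qed.

Lemma tail_sub (x y : nat -> R) : ex_series x -> ex_series y ->
  tail (x - y)%fps = (tail x - tail y)%fps.
Proof.
assert (E : forall (z : nat -> R) n, ex_series z -> ex_series (fun k => z (n + S k)%nat)).
{ intros z n H. apply (ex_series_incr_n z (S n)) in H. revert H. apply ex_series_ext.
  intro k. f_equal; lia. }
intros Hx Hy. apply functional_extensionality; intro n. unfold tail, fsub.
rewrite <- Series_minus; auto.
Qed.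

Lemma tail_of_nabla (x : nat -> R) : is_lim_seq x 0 -> tail (nabla x) = (- x)%fps.
Proof.
intro H. apply functional_extensionality; intro n. unfold tail, fopp.
apply is_series_unique.
apply (is_series_ext (fun k => - (x (n + k)%nat - x (n + S k)%nat))).
- intro k. replace (n + S k)%nat with (S (n + k)) by lia. rewrite nabla_S. simpl. ring.
- replace (x n) with (x (n + 0)%nat) by (f_equal; lia).
  apply (is_series_opp (V := R_NormedModule) (fun k => x (n + k)%nat - x (n + S k)%nat)).
  apply (is_series_telescope (fun k => x (n + k)%nat)).
  apply (is_lim_seq_incr_n _ n) in H. revert H. apply is_lim_seq_ext.
  intro k; f_equal; lia.
Qed.

(* Summation by parts: [q] is the summatory function of [p]. *)
Lemma tail_moment (p q x : nat -> R) (l : R) :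
  q O = 0 -> (forall n, q (S n) - q n = p n) -> ex_series x ->
  is_lim_seq (fun n => q (S n) * tail x n) 0 ->
  is_series (fun n => q n * x n) l -> is_series (fun n => p n * tail x n) l.
Proof.
intros q0 qS Hx Hlim Hs.
change (is_lim_seq (sum_n (fun n => p n * tail x n)) l).
change (is_lim_seq (sum_n (fun n => q n * x n)) l) in Hs.
apply (is_lim_seq_ext
  (fun n => sum_n (fun k => q k * x k) n + q (S n) * tail x n)).
- intro n. induction n as [|n IH].
  + rewrite !sum_O, <- qS, q0. simpl. ring.
  + rewrite !sum_Sn, <- IH, <- qS, (tail_step x n) by assumption.
    unfold plus; simpl. ring.
- replace (Finite l) with (Finite (l + 0)) by (f_equal; ring).
  apply is_lim_seq_plus'; assumption.
Qed.

Lemma dominated_lim0 (s p : nat) (x : nat -> R) : dominated (S s) 0 x -> is_lim_seq x 0.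
Proof.
intro H. apply (dominated_le (S s) 1 0 0) in H; try lia.
destruct H as [K [HK H]].
apply is_lim_seq_abs_0.
apply (is_lim_seq_le_le (fun _ => 0) _ (fun n => K * / (INR n + 1))).
- intro n. split; [apply Rabs_pos|]. eapply Rle_trans; [apply H|].
  right. unfold weight; simpl. field. apply Rgt_not_eq, INR1_pos.
- apply is_lim_seq_const.
- replace (Finite 0) with (Rbar_mult K 0) by (simpl; f_equal; ring).
  apply is_lim_seq_scal_l. apply (is_lim_seq_inv_shift 0).
Qed.

Lemma moment_lim0 (j : nat) (q x : nat -> R) :
  (forall n, Rabs (q (S n)) <= (INR n + 1) ^ j) -> dominated (S j) 0 x ->
  is_lim_seq (fun n => q (S n) * x n) 0.
Proof.
intros Hq [K [HK Hx]]. apply (dominated_lim0 0 0). exists K; split; [assumption|].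
intro n. rewrite Rabs_mult.
apply Rle_trans with ((INR n + 1) ^ j * (K * weight (S j) 0 n)).
- apply Rmult_le_compat; auto using Rabs_pos.
- right. unfold weight. simpl. field. pose proof (INR1_pos n).
  split; try apply pow_nonzero; lra.
Qed.

(** * Reciprocals of log-convex series *)

(** The inverse is a fixed point of [inv_step]. Coefficient [n + 1] needs all the earlier ones, so
    the step is iterated from [f0]: after [k] rounds the coefficients below [k] are final
    ([inv_step_iter]). *)
Definition inv_step (x v : nat -> R) (n : nat) : R :=
  match n with O => / x O | S m => - / x O * (shl x * v)%fps m end.
Definition finv (x : nat -> R) (n : nat) : R := Nat.iter (S n) (inv_step x) f0 n.

Lemma inv_step_iter (x : nat -> R) (k : nat) : forall k' n, (n < k)%nat -> (n < k')%nat ->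
  Nat.iter k (inv_step x) f0 n = Nat.iter k' (inv_step x) f0 n.
Proof.
induction k as [|k IH]; intros k' n Hk Hk'; [lia|].
destruct k' as [|k']; [lia|]. simpl. destruct n as [|n]; [reflexivity|].
simpl. f_equal. apply conv_ext; [reflexivity|]. intros j Hj. apply IH; lia.
Qed.

Lemma conv_finv (x : nat -> R) : x O <> 0 -> (x * finv x)%fps = f1.
Proof.
intro H. apply functional_extensionality; intros [|n].
- unfold finv, f1, cst, delta; simpl. field; assumption.
- change ((x * finv x)%fps (S n)) with (x O * finv x (S n) + (shl x * finv x)%fps n).
  assert (E : finv x (S n) = - / x O * (shl x * finv x)%fps n).
  { unfold finv at 1. change (Nat.iter (S (S n)) (inv_step x) f0)
      with (inv_step x (Nat.iter (S n) (inv_step x) f0)). simpl inv_step. f_equal.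
    apply conv_ext; [reflexivity|]. intros j Hj. apply (inv_step_iter x (S n) (S j)); lia. }
  rewrite E. unfold f1, cst, delta; simpl. field; assumption.
Qed.

(** The ratios [b (S n) / b n] are nondecreasing, in cross-multiplied form; the induction multiplies
    by [b (j + d)] to chain two of these inequalities. *)
Lemma log_convex_mono (b : nat -> R) :
  (forall n, 0 < b n) -> (forall n, b (S n) ^ 2 <= b n * b (S (S n))) ->
  forall j d, b (S j) * b (j + d)%nat <= b (S (j + d)) * b j.
Proof.
intros Hb Hc j d. induction d as [|d IH].
- rewrite Nat.add_0_r. lra.
- replace (j + S d)%nat with (S (j + d)) by lia.
  pose proof (Hb (j + d)%nat) as P0. pose proof (Hb (S (j + d))) as P1.
  pose proof (Hb (S (S (j + d)))) as P2. pose proof (Hb j). pose proof (Hb (S j)).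
  specialize (Hc (j + d)%nat).
  set (u := b (j + d)%nat) in *. set (v := b (S (j + d))) in *. set (w := b (S (S (j + d)))) in *.
  apply Rmult_le_reg_l with u; [assumption|].
  apply Rle_trans with (v * (v * b j)).
  + replace (u * (b (S j) * v)) with (v * (b (S j) * u)) by ring.
    apply Rmult_le_compat_l; lra.
  + replace (v * (v * b j)) with (v ^ 2 * b j) by ring.
    replace (u * (w * b j)) with (u * w * b j) by ring.
    apply Rmult_le_compat_r; lra.
Qed.

(** Strong induction comparing two consecutive coefficient relations of [b v = 1]: rescaled so that
    their terms in [v 0] agree, they differ only in terms whose sign is fixed by the induction
    hypothesis and the monotone ratios. *)
Lemma kaluza (b v : nat -> R) :
  (forall n, 0 < b n) -> (forall n, b (S n) ^ 2 <= b n * b (S (S n))) ->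
  (b * v)%fps = f1 -> forall n, v (S n) <= 0.
Proof.
intros Hb Hc Hbv.
assert (E : forall n, sum_f_R0 (fun k => v k * b (S n - k)%nat) n + v (S n) * b O = 0).
{ intro n. assert (H : (v * b)%fps (S n) = 0).
  { replace (v * b)%fps with (b * v)%fps by ring. rewrite Hbv.
    unfold f1, cst, delta; simpl; ring. }
  rewrite conv_sum, tech5, Nat.sub_diag in H. exact H. }
assert (V0 : v O * b O = 1).
{ assert (H : (b * v)%fps O = 1) by (rewrite Hbv; unfold f1, cst, delta; simpl; ring).
  simpl in H. lra. }
intro n. induction n as [n IH] using (well_founded_induction lt_wf).
pose proof (Hb O) as P0. pose proof (Hb 1%nat) as P1.
enough (H : 0 <= sum_f_R0 (fun k => v k * b (S n - k)%nat) n) by (specialize (E n); nra).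
destruct n as [|n]; [simpl; nra|].
specialize (E n). rewrite <- (Nat.sub_diag (S n)), <- tech5 in E.
apply Rmult_le_reg_l with (b (S n)); [apply Hb|].
(* The zero on the left becomes [b (S (S n))] times the relation of index [S n], and the sums are
   compared termwise: equality at [k = 0], and [log_convex_mono] multiplied by a nonpositive [v]
   elsewhere. *)
rewrite Rmult_0_r, <- (Rmult_0_r (b (S (S n)))), <- E, !scal_sum.
apply sum_Rle. intros k Hk. destruct k as [|k].
- rewrite !Nat.sub_0_r. lra.
- specialize (IH k ltac:(lia)).
  assert (L := log_convex_mono b Hb Hc (S n - S k) (S k)).
  replace (S n - S k + S k)%nat with (S n) in L by lia.
  replace (S (S n) - S k)%nat with (S (S n - S k)) by lia. nra.
Qed.

(** With the signs known there is no cancellation to control: in the relation of index [S n] the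
    intermediate terms are nonpositive, so the positive term [v 0 * b (S n)] alone limits
    [v (S n)]. *)
Lemma kaluza_bound (b v : nat -> R) :
  (forall n, 0 < b n) -> (forall n, b (S n) ^ 2 <= b n * b (S (S n))) ->
  (b * v)%fps = f1 -> forall n, Rabs (v (S n)) <= b (S n) / b O ^ 2.
Proof.
intros Hb Hc Hbv n. pose proof (kaluza b v Hb Hc Hbv) as Hv.
assert (V0 : v O = / b O).
{ assert (H : (b * v)%fps O = 1) by (rewrite Hbv; unfold f1, cst, delta; simpl; ring).
  simpl in H. pose proof (Hb O). apply Rmult_eq_reg_l with (b O); [|lra].
  rewrite H; field; lra. }
assert (H : (v * b)%fps (S n) = 0).
{ replace (v * b)%fps with (b * v)%fps by ring. rewrite Hbv.
  unfold f1, cst, delta; simpl; ring. }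
rewrite conv_sum, tech5, Nat.sub_diag in H.
assert (L : sum_f_R0 (fun k => v k * b (S n - k)%nat) n <= v O * b (S n)).
{ destruct n as [|n]; [simpl; lra|]. rewrite decomp_sum by lia.
  rewrite Nat.sub_0_r.
  enough (sum_f_R0 (fun i => v (S i) * b (S (S n) - S i)%nat) (Nat.pred (S n)) <= 0) by lra.
  rewrite <- (Rmult_0_l (INR (S (Nat.pred (S n))))), <- sum_cte.
  apply sum_Rle. intros k _. specialize (Hv k). pose proof (Hb (S (S n) - S k)%nat). nra. }
rewrite Rabs_left1 by apply Hv. pose proof (Hb O).
apply Rmult_le_reg_r with (b O); [assumption|].
replace (b (S n) / b O ^ 2 * b O) with (v O * b (S n)) by (rewrite V0; field; lra).
lra.
Qed.

(** * The renewal sequence *)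

(** Coefficients of [Li_s]: [ipow 1] is [- ln(1 - z)] and [ipow 0] is [z/(1 - z)], whose constant
    term is 0. *)
Definition ipow (s n : nat) : R := match n with O => 0 | _ => / INR n ^ s end.

Lemma theta_ipow (s : nat) : theta (ipow (S s)) = ipow s.
Proof.
apply functional_extensionality; intros [|n]; unfold theta, ipow.
- simpl; ring.
- pose proof (INR1_pos n) as H. rewrite <- S_INR in H.
  rewrite <- tech_pow_Rmult. field. split; try apply pow_nonzero; lra.
Qed.

(** The Euler operator lowers [s] to 0, and [z/(1 - z)] becomes a polynomial after one
    difference. *)
Lemma symb_ipow (N s : nat) : symb N s 0 (ipow s).
Proof.
induction s as [|s IH].
- apply (symb_le (S N) N 0 0 0 0); try lia. apply symb_S.
  + exists 1; split; [lra|]. intro n. unfold weight. simpl.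
    unfold ipow. destruct n; [rewrite Rabs_R0; lra|].
    rewrite pow_O, Rinv_1, Rabs_R1. lra.
  + apply (symb_finite 2). intros [|[|n]] Hn; try lia. rewrite nabla_S.
    unfold ipow; simpl. field.
- apply symb_theta_inv. rewrite theta_ipow. exact IH.
Qed.

Definition z2 : R := Series (ipow 2).
Definition z3 : R := Series (ipow 3).
(* With [a = ipow 3] the coefficients of [Li3]: [z3 - a = (1 - z) Bs],
   [Bs = z2 - (1 - z) Ts], [Vs = 1 / Bs] and [Us = S0 / zeta(3)]. *)
Definition Bs : nat -> R := tail (ipow 3).
Definition Ts : nat -> R := tail Bs.
Definition Vs : nat -> R := finv Bs.

Lemma symb_Bs (N : nat) : symb N 2 0 Bs.
Proof.
apply (symb_le (S N) N 2 2 0 0); try lia. apply symb_tail. apply symb_ipow.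
Qed.

Lemma symb_Ts (N : nat) : symb N 1 0 Ts.
Proof.
apply (symb_le (S N) N 1 1 0 0); try lia. apply symb_tail. apply symb_Bs.
Qed.

Lemma ex_series_ipow (s : nat) : ex_series (ipow (S (S s))).
Proof.
apply dominated_ex_series. apply (dominated_le (S (S s)) 2 0 0); try lia.
apply (symb_dominated 0), symb_ipow.
Qed.

Lemma ex_series_Bs : ex_series Bs.
Proof. apply dominated_ex_series, (symb_dominated 0), symb_Bs. Qed.

(** Exchanging the two summations counts [1/k^3] once for each [n < k], so [B(1)] is the sum of
    [k/k^3]. *)
Lemma is_series_Bs : is_series Bs z2.
Proof.
apply (is_series_ext (fun n => 1 * Bs n)); [intro n; apply Rmult_1_l|].
apply (tail_moment (fun _ => 1) INR (ipow 3)).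
- reflexivity.
- intro n. rewrite S_INR. ring.
- apply ex_series_ipow.
- apply (moment_lim0 1).
  + intro n. rewrite S_INR, Rabs_pos_eq by (left; apply INR1_pos). lra.
  + apply (symb_dominated 0), symb_Bs.
- apply (is_series_ext (ipow 2)).
  + intro n. rewrite <- theta_ipow. reflexivity.
  + apply Series_correct, ex_series_ipow.
Qed.

Lemma nabla_Bs : nabla Bs = (cst z3 - ipow 3)%fps.
Proof. apply nabla_tail, ex_series_ipow. Qed.

Lemma nabla_Ts : nabla Ts = (cst z2 - Bs)%fps.
Proof.
unfold Ts. rewrite nabla_tail by apply ex_series_Bs.
rewrite (is_series_unique _ _ is_series_Bs). reflexivity.
Qed.

(* [c m = 1 / ((m+1)^3 - m^3)] satisfies [c m - c (m+1) <= 1/(m+1)^3]. *)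
Lemma Bs_lower (m : nat) : / (3 * INR m ^ 2 + 3 * INR m + 1) <= Bs m.
Proof.
set (c := fun k => / (3 * INR (m + k) ^ 2 + 3 * INR (m + k) + 1)).
assert (Hc : is_lim_seq c 0).
{ apply (is_lim_seq_le_le (fun _ => 0) _ (fun k => / (INR (m + k) + 1))).
  - intro k. unfold c. pose proof (pos_INR (m + k)). split.
    + left; apply Rinv_0_lt_compat; nra.
    + apply Rinv_le_contravar; nra.
  - apply is_lim_seq_const.
  - apply is_lim_seq_inv_shift. }
assert (G := is_series_telescope c Hc).
replace (/ (3 * INR m ^ 2 + 3 * INR m + 1)) with (c 0%nat)
  by (unfold c; rewrite Nat.add_0_r; reflexivity).
rewrite <- (is_series_unique _ _ G). apply Series_le.
- intro k. unfold c. replace (m + S k)%nat with (S (m + k)) by lia.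
  unfold ipow. rewrite S_INR. pose proof (pos_INR (m + k)) as Hk.
  set (u := INR (m + k)) in *. split.
  + apply (proj1 (Rminus_le_0 _ _)). apply Rinv_le_contravar; nra.
  + apply Rminus_le_0.
    replace (_ - _) with ((3 * (u + 1) ^ 4 - 3 * (u + 1) ^ 2 + 1)
      / ((u + 1) ^ 3 * (3 * u ^ 2 + 3 * u + 1) * (3 * (u + 1) ^ 2 + 3 * (u + 1) + 1))).
    * apply Rdiv_le_0_compat.
      -- assert (0 <= u * (u + 1) ^ 2) by (apply Rmult_le_pos; [|apply pow_le]; lra). nra.
      -- repeat apply Rmult_lt_0_compat; try apply pow_lt; nra.
    * field. repeat split; nra.
- assert (H := ex_series_ipow 1). apply (ex_series_incr_n _ (S m)) in H. revert H.
  apply ex_series_ext. intro k. f_equal; lia.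
Qed.

Lemma Bs_pos (m : nat) : 0 < Bs m.
Proof.
eapply Rlt_le_trans; [|apply Bs_lower]. pose proof (pos_INR m).
apply Rinv_0_lt_compat; nra.
Qed.

(** With [m = n + 1] and [b = Bs m], the neighbours are [b + 1/m^3] and [b - 1/(m+1)^3]. The
    inequality is then exactly [b ((m+1)^3 - m^3) >= 1], which is [Bs_lower]. *)
Lemma Bs_log_convex (n : nat) : Bs (S n) ^ 2 <= Bs n * Bs (S (S n)).
Proof.
assert (E1 : Bs n = ipow 3 (S n) + Bs (S n)) by (apply tail_step, ex_series_ipow).
assert (E2 : Bs (S n) = ipow 3 (S (S n)) + Bs (S (S n))) by (apply tail_step, ex_series_ipow).
assert (L := Bs_lower (S n)). rewrite E1.
replace (Bs (S (S n))) with (Bs (S n) - ipow 3 (S (S n))) by lra.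
unfold ipow. rewrite (S_INR (S n)). set (m := INR (S n)) in *.
assert (Hm : 1 <= m) by (apply (le_INR 1); lia).
set (q := 3 * m ^ 2 + 3 * m + 1) in *. assert (Hq : 0 < q) by (unfold q; nra).
assert (Hb : / q * q = 1) by (field; lra).
assert (0 <= Bs (S n) * q - 1).
{ replace (Bs (S n) * q - 1) with ((Bs (S n) - / q) * q) by lra.
  apply Rmult_le_pos; lra. }
apply Rminus_le_0.
replace (_ - _) with ((Bs (S n) * q - 1) / (m ^ 3 * (m + 1) ^ 3)).
- apply Rdiv_le_0_compat; [assumption|]. apply Rmult_lt_0_compat; apply pow_lt; lra.
- unfold q. field. lra.
Qed.

Lemma Bs_Vs : (Bs * Vs)%fps = f1.
Proof. apply conv_finv. pose proof (Bs_pos 0); lra. Qed.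

Lemma dominated_Vs : dominated 2 0 Vs.
Proof.
destruct (symb_dominated 0 2 0 _ (symb_Bs 0)) as [K [HK H]].
apply (dominated_eventually 1 2 0 _ (K / Bs 0 ^ 2)). intros [|n] Hn; [lia|].
eapply Rle_trans; [apply (kaluza_bound Bs Vs Bs_pos Bs_log_convex Bs_Vs)|].
specialize (H (S n)). rewrite Rabs_pos_eq in H by (left; apply Bs_pos).
replace (K / Bs 0 ^ 2 * weight 2 0 (S n)) with (K * weight 2 0 (S n) * / Bs 0 ^ 2).
- apply Rmult_le_compat_r; [|assumption]. left; apply Rinv_0_lt_compat, pow_lt, Bs_pos.
- field. pose proof (Bs_pos 0). lra.
Qed.

(* [theta] is a derivation, so [theta V = - theta B * V^2]; this gains one
   difference of regularity on [V] per step. *)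
Lemma symb_Vs (N : nat) : symb N 2 0 Vs.
Proof.
assert (E : theta Vs = (- (theta Bs * (Vs * Vs)))%fps).
{ assert (H : theta (Bs * Vs)%fps = f0).
  { rewrite Bs_Vs. apply functional_extensionality; intros [|n];
      unfold theta, f0, f1, cst, delta; simpl; ring. }
  rewrite theta_mul in H.
  transitivity (theta Vs * (Bs * Vs))%fps; [rewrite Bs_Vs; ring|].
  replace (theta Vs * (Bs * Vs))%fps
    with (Vs * (theta Bs * Vs + Bs * theta Vs) - theta Bs * (Vs * Vs))%fps by ring.
  rewrite H. ring. }
assert (HB : forall M, symb M 1 0 (theta Bs)) by (intro M; apply symb_theta, symb_Bs).
induction N as [|N IH].
- intros i Hi. replace i with 0%nat by lia. apply dominated_Vs.
- apply symb_theta_inv, symb_S.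
  + apply dominated_theta, dominated_Vs.
  + rewrite E. replace (nabla (- (theta Bs * (Vs * Vs)))%fps)
      with (- (nabla (theta Bs) * (Vs * Vs)))%fps by (unfold nabla; ring).
    apply symb_opp, symb_mul_22.
    * apply symb_nabla, HB.
    * apply symb_mul_22; exact IH.
Qed.

Definition Us (n : nat) : R := sum_f_R0 Vs n.

Lemma nabla_Us : nabla Us = Vs.
Proof.
apply functional_extensionality; intros [|n].
- rewrite nabla_0. reflexivity.
- rewrite nabla_S. unfold Us. rewrite tech5. ring.
Qed.

Lemma Us_renewal : ((cst z3 - ipow 3) * Us)%fps = f1.
Proof.
rewrite <- nabla_Bs, <- Bs_Vs, <- nabla_Us. unfold nabla. ring.
Qed.

Definition ones (n : nat) : R := 1.

Lemma nabla_ones : nabla ones = f1.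
Proof.
apply functional_extensionality; intros [|n].
- rewrite nabla_0. unfold ones, f1, cst, delta; simpl; ring.
- rewrite nabla_S. unfold ones, f1, cst, delta; simpl; ring.
Qed.

(** Scaled by [zeta(2)^4] to avoid division. After one difference it is the relation
    [zeta(2) V = 1 + (1 - z) T V] substituted into itself four times. *)
Lemma Us_expansion :
  (cst z2 * cst z2 * cst z2 * cst z2 * Us
   = cst z2 * cst z2 * cst z2 * ones + cst z2 * cst z2 * Ts
     + cst z2 * nabla (Ts * Ts) + iter_nabla 2 (Ts * Ts * Ts)
     + iter_nabla 3 (Ts * Ts * Ts * Ts * Vs))%fps.
Proof.
apply nabla_inj. simpl Nat.iter.
assert (EV : (cst z2 * Vs = f1 + nabla Ts * Vs)%fps)
  by (rewrite nabla_Ts, <- Bs_Vs; ring).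
transitivity (cst z2 * cst z2 * cst z2 * (cst z2 * Vs))%fps.
{ rewrite <- nabla_Us. unfold nabla; ring. }
transitivity (cst z2 * cst z2 * cst z2 * nabla ones + cst z2 * cst z2 * nabla Ts
  + cst z2 * (nabla Ts * nabla Ts) + (nabla Ts * nabla Ts * nabla Ts)
  + nabla Ts * nabla Ts * nabla Ts * nabla Ts * Vs)%fps; [|unfold nabla; ring].
rewrite nabla_ones. rewrite EV.
transitivity (cst z2 * cst z2 * cst z2 + cst z2 * cst z2 * nabla Ts * (cst z2 * Vs))%fps;
  [ring|]. rewrite EV.
transitivity (cst z2 * cst z2 * cst z2 + cst z2 * cst z2 * nabla Ts
  + cst z2 * nabla Ts * nabla Ts * (cst z2 * Vs))%fps;
  [ring|]. rewrite EV.
transitivity (cst z2 * cst z2 * cst z2 + cst z2 * cst z2 * nabla Ts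
  + cst z2 * nabla Ts * nabla Ts + nabla Ts * nabla Ts * nabla Ts * (cst z2 * Vs))%fps;
  [ring|]. rewrite EV. ring.
Qed.

(** * Expansion of [T] at the singularity *)

(* The coefficients of [- ln(1 - z) / 2]. *)
Definition hl : nat -> R := (cst (1 / 2) * ipow 1)%fps.
Definition Ws : nat -> R :=
  (hl + nabla hl + cst (11 / 24) * nabla (nabla (ipow 1)))%fps.
(* The coefficients in [Ws] are those for which [Gs n = O(1/n^6)]; the Taylor
   coefficients of [Gs] at [z = 1] are then its binomial moments [m2], [m3]. *)
Definition Gs : nat -> R := (ipow 3 - nabla (nabla Ws))%fps.

Lemma symb_hl (N : nat) : symb N 1 0 hl.
Proof. apply symb_cst, symb_ipow. Qed.

Lemma symb_Ws (N : nat) : symb N 1 0 Ws.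
Proof.
assert (H : forall x, symb (S N) 1 0 x -> symb N 1 0 (nabla x)).
{ intros x Hx. apply (symb_le N N 2 1 0 0); try lia. apply symb_nabla, Hx. }
unfold Ws. repeat apply symb_add.
- apply symb_hl.
- apply H, symb_hl.
- apply symb_cst, H, (symb_le (S N) (S N) 2 1 0 0); try lia.
  apply symb_nabla, symb_ipow.
Qed.

Lemma Gs_eq (n : nat) : Gs n = ipow 3 n
  - (1 / 2 * nabla (nabla (ipow 1)) n + 1 / 2 * nabla (nabla (nabla (ipow 1))) n
     + 11 / 24 * nabla (nabla (nabla (nabla (ipow 1)))) n).
Proof.
replace Gs with (ipow 3 - (cst (1 / 2) * nabla (nabla (ipow 1))
  + cst (1 / 2) * nabla (nabla (nabla (ipow 1)))
  + cst (11 / 24) * nabla (nabla (nabla (nabla (ipow 1))))))%fps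
  by (unfold Gs, Ws, hl, nabla; ring).
unfold fsub, fadd. rewrite !conv_cst. reflexivity.
Qed.

(** The fourth difference reaches back four indices, so 5 is the first index where the value
    [ipow 1 0 = 0] is not involved. The denominator exceeds the numerator by six degrees. *)
Lemma Gs_rational (m : nat) : let x := INR m in
  Gs (5 + m) = - (50 * x + 226)
    / ((x + 5) ^ 3 * (x + 4) * (x + 3) * (x + 2) * (x + 1)).
Proof.
intro x. rewrite Gs_eq. change (5 + m)%nat with (S (S (S (S (S m))))). rewrite !nabla_S. unfold ipow.
rewrite !S_INR. fold x. pose proof (pos_INR m : 0 <= x). field. lra.
Qed.

Lemma dominated_Gs : dominated 6 0 Gs.
Proof.
(* The constant combines [50 x + 226 <= 50 (x + 5)] with [x + 6 <= 6 (x + 1)]. *)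
apply (dominated_eventually 5 6 0 Gs (50 * 6 ^ 6)). intros n Hn.
replace n with (5 + (n - 5))%nat by lia. set (m := (n - 5)%nat).
rewrite Gs_rational. unfold weight. rewrite plus_INR, pow_O.
replace (INR 5) with 5 by (simpl; ring).
pose proof (pos_INR m). set (x := INR m) in *.
unfold Rdiv. rewrite Ropp_mult_distr_l_reverse, Rabs_Ropp, Rabs_pos_eq.
- apply Rle_trans with (50 * / (x + 1) ^ 6).
  + replace (50 * / (x + 1) ^ 6) with (50 * (x + 5) * / ((x + 5) * (x + 1) ^ 6))
      by (field; lra).
    apply Rmult_le_compat; [lra| |lra|].
    * left; apply Rinv_0_lt_compat. repeat apply Rmult_lt_0_compat; try apply pow_lt; lra.
    * apply Rinv_le_contravar; [apply Rmult_lt_0_compat; [|apply pow_lt]; lra|].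
      replace ((x + 5) ^ 3 * (x + 4) * (x + 3) * (x + 2) * (x + 1))
        with ((x + 5) * ((x + 5) * ((x + 5) * ((x + 4) * ((x + 3) * ((x + 2) * (x + 1)))))))
        by ring.
      apply Rmult_le_compat_l; [lra|]. simpl pow. rewrite Rmult_1_r.
      repeat (apply Rmult_le_compat; try lra;
              try (repeat apply Rmult_le_pos; lra)).
  + replace (50 * 6 ^ 6 * (1 * / (5 + x + 1) ^ 6))
      with (50 * / ((x + 6) / 6) ^ 6) by (field; lra).
    apply Rmult_le_compat_l; [lra|]. apply Rinv_le_contravar; [apply pow_lt; lra|].
    apply pow_incr; lra.
- apply Rmult_le_pos; [lra|]. left; apply Rinv_0_lt_compat.
  repeat apply Rmult_lt_0_compat; try apply pow_lt; lra.
Qed.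

(** * Binomial moments of [Gs], and the constants of the expansion of [T] *)

Definition binom2 (n : nat) : R := INR n * (INR n - 1) / 2.
Definition binom3 (n : nat) : R := INR n * (INR n - 1) * (INR n - 2) / 6.
Definition m2 : R := 3 / 4 - z2 / 2.
Definition m3 : R := z2 / 3 - 7 / 12.

(** Reduces a sum to a closed form of its partial sums: a multiple of those of [zeta(2)] plus a
    sequence with known limit. *)
Lemma is_series_shift_limit (u d : nat -> R) (k : nat) (c l : R) :
  (forall m, sum_n u (k + m) = c * sum_n (ipow 2) (k + m) + d m :> R) ->
  is_lim_seq d (l - c * z2) -> is_series u l.
Proof.
intros H Hd. change (is_lim_seq (sum_n u) l).
apply (is_lim_seq_incr_n _ k).
apply (is_lim_seq_ext (fun m => c * sum_n (ipow 2) (m + k) + d m)).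
- intro m. rewrite (Nat.add_comm m k), H. reflexivity.
- replace (Finite l) with (Finite (c * z2 + (l - c * z2))) by (f_equal; ring).
  apply is_lim_seq_plus'; [|assumption].
  apply (is_lim_seq_scal_l _ c z2).
  apply -> (is_lim_seq_incr_n (sum_n (ipow 2)) k).
  apply Series_correct, ex_series_ipow.
Qed.

Lemma is_lim_seq_inv_comb (c a0 a1 a2 a3 : R) :
  is_lim_seq (fun m => c + a0 * / (INR m + 1) + a1 * / (INR (1 + m) + 1)
                         + a2 * / (INR (2 + m) + 1) + a3 * / (INR (3 + m) + 1)) c.
Proof.
assert (H : forall a k, is_lim_seq (fun m => a * / (INR (k + m) + 1)) 0).
{ intros a k. replace (Finite 0) with (Rbar_mult a 0) by (simpl; f_equal; ring).
  apply is_lim_seq_scal_l, is_lim_seq_inv_shift. }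
replace (Finite c) with (Finite (c + 0 + 0 + 0 + 0)) by (f_equal; ring).
repeat apply is_lim_seq_plus'; try apply H.
- apply is_lim_seq_const.
- apply (H a0 0%nat).
Qed.

Lemma sum_n_S (u : nat -> R) (n : nat) : sum_n u (S n) = sum_n u n + u (S n) :> R.
Proof. rewrite sum_Sn. reflexivity. Qed.

Lemma is_series_binom3_Gs : is_series (fun n => binom3 n * Gs n) m3.
Proof.
(* In partial fractions the summand has coefficient [1/3] at [1/n^2]; the residues of its simple
   poles add up to 0, so these telescope to the four reciprocals listed. *)
apply (is_series_shift_limit _ _ 4 (1 / 3)) with
 (2 := is_lim_seq_inv_comb (m3 - 1 / 3 * z2) (11 / 6) (- (1 / 2)) (- (1 / 2)) (- (1 / 2))).
induction m as [|m IH].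
(* Indices 0 to 4 lie below the range of [Gs_rational] and are evaluated directly; they fix the
   rational part of the constant. *)
- simpl Nat.add. rewrite !sum_n_S, !sum_O.
  rewrite !Gs_eq, !nabla_S, !nabla_0. unfold binom3, m3, ipow. simpl. field.
- replace (4 + S m)%nat with (S (4 + m)) by lia. rewrite !(sum_n_S _ (4 + m)), IH.
 
  change (S (4 + m)) with (5 + m)%nat. rewrite Gs_rational.
  unfold binom3, ipow. change (5 + m)%nat with (S (S (S (S (S m))))).
  simpl Nat.add. rewrite !S_INR. pose proof (pos_INR m). field. lra.
Qed.

Lemma is_series_binom2_Gs : is_series (fun n => binom2 n * Gs n) m2.
Proof.
apply (is_series_shift_limit _ _ 4 (- (1 / 2))) with
 (2 := is_lim_seq_inv_comb (m2 - - (1 / 2) * z2) (11 / 4) (- (17 / 4)) (1 / 2) (1 / 2)).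
induction m as [|m IH].
- simpl Nat.add. rewrite !sum_n_S, !sum_O.
  rewrite !Gs_eq, !nabla_S, !nabla_0. unfold binom2, m2, ipow. simpl. field.
- replace (4 + S m)%nat with (S (4 + m)) by lia. rewrite !(sum_n_S _ (4 + m)), IH.
 
  change (S (4 + m)) with (5 + m)%nat. rewrite Gs_rational.
  unfold binom2, ipow. change (5 + m)%nat with (S (S (S (S (S m))))).
  simpl Nat.add. rewrite !S_INR. pose proof (pos_INR m). field. lra.
Qed.

Definition Ys : nat -> R := tail (tail Gs).

(** Starting from mere size [n^(-6)], each tail trades one power of [n] for one controlled
    difference. *)
Lemma symb_tail_Gs : symb 1 5 0 (tail Gs) /\ symb 2 4 0 Ys /\ symb 3 3 0 (tail Ys).
Proof.
assert (H0 : symb 0 6 0 Gs).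
{ intros i Hi. replace i with 0%nat by lia. apply dominated_Gs. }
assert (H1 : symb 1 5 0 (tail Gs)) by apply (symb_tail 0 4 Gs H0).
assert (H2 : symb 2 4 0 Ys) by apply (symb_tail 1 3 _ H1).
split; [|split]; try assumption. apply (symb_tail 2 2 _ H2).
Qed.

(** With the next two lemmas, the hockey-stick chain from [1] to [n], [binom2], [binom3]: the sum of
    an iterated tail is a binomial moment of the original sequence. *)
Lemma tail_moment0 (x : nat -> R) (l : R) : dominated 3 0 x ->
  is_series (fun n => INR n * x n) l -> is_series (fun n => 1 * tail x n) l.
Proof.
intros Hx. apply tail_moment; [reflexivity| | |].
- intro n. rewrite S_INR. ring.
- apply dominated_ex_series, (dominated_le 3 2 0 0); auto.
- apply (moment_lim0 1); [|apply (dominated_tail 1), Hx].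
  intro n. pose proof (INR1_pos n). rewrite S_INR, Rabs_pos_eq; simpl; lra.
Qed.

Lemma tail_moment1 (x : nat -> R) (l : R) : dominated 4 0 x ->
  is_series (fun n => binom2 n * x n) l -> is_series (fun n => INR n * tail x n) l.
Proof.
intros Hx. apply tail_moment.
- unfold binom2; simpl; field.
- intro n. unfold binom2. rewrite S_INR. field.
- apply dominated_ex_series, (dominated_le 4 2 0 0); auto with arith.
- apply (moment_lim0 2); [|apply (dominated_tail 2), Hx].
  intro n. pose proof (pos_INR n). unfold binom2. rewrite S_INR, Rabs_pos_eq; nra.
Qed.

Lemma tail_moment2 (x : nat -> R) (l : R) : dominated 5 0 x ->
  is_series (fun n => binom3 n * x n) l -> is_series (fun n => binom2 n * tail x n) l.
Proof.
intros Hx. apply tail_moment.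
- unfold binom3; simpl; field.
- intro n. unfold binom3, binom2. rewrite S_INR. field.
- apply dominated_ex_series, (dominated_le 5 2 0 0); auto with arith.
- apply (moment_lim0 3); [|apply (dominated_tail 3), Hx].
  intro n. unfold binom3.
  assert (Hn : 0 <= INR n * (INR n - 1)).
  { destruct n as [|n]; [simpl; lra|]. rewrite S_INR. pose proof (pos_INR n). nra. }
  pose proof (pos_INR n). rewrite S_INR, Rabs_pos_eq.
  + replace ((INR n + 1) * (INR n + 1 - 1) * (INR n + 1 - 2) / 6)
      with ((INR n + 1) * (INR n * (INR n - 1)) / 6) by field.
    simpl. rewrite Rmult_1_r. unfold Rdiv. rewrite Rmult_assoc.
    apply Rmult_le_compat_l; nra.
  + replace ((INR n + 1) * (INR n + 1 - 1) * (INR n + 1 - 2) / 6)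
      with ((INR n + 1) * (INR n * (INR n - 1)) / 6) by field.
    apply Rdiv_le_0_compat; [apply Rmult_le_pos|]; lra.
Qed.

Lemma Series_Ys : Series Ys = m2.
Proof.
destruct symb_tail_Gs as [H1 [H2 H3]]. apply is_series_unique.
apply (is_series_ext (fun n => 1 * Ys n)); [intro n; apply Rmult_1_l|].
apply tail_moment0.
- apply (dominated_le 5 3 0 0); try lia. apply (symb_dominated 1), H1.
- apply tail_moment1, is_series_binom2_Gs.
  apply (dominated_le 6 4 0 0); try lia. apply dominated_Gs.
Qed.

Lemma Series_tail_Ys : Series (tail Ys) = m3.
Proof.
destruct symb_tail_Gs as [H1 [H2 H3]]. apply is_series_unique.
apply (is_series_ext (fun n => 1 * tail Ys n)); [intro n; apply Rmult_1_l|].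
apply tail_moment0.
- apply (dominated_le 4 3 0 0); try lia. apply (symb_dominated 2), H2.
- apply tail_moment1.
  + apply (dominated_le 5 4 0 0); try lia. apply (symb_dominated 1), H1.
  + apply tail_moment2, is_series_binom3_Gs.
    apply (dominated_le 6 5 0 0); try lia. apply dominated_Gs.
Qed.

(** Two tails turn [ipow 3] into [Ts]. They turn the second difference of [Ws] back into [Ws]: each
    tail undoes one difference up to sign, because the sequences tend to 0, and the two signs
    cancel. *)
Lemma Ys_eq : Ys = (Ts - Ws)%fps.
Proof.
assert (L : forall N x, symb N 1 0 x -> is_lim_seq x 0)
  by (intros N x H; apply (dominated_lim0 0 0), (symb_dominated N), H).
assert (HnW : symb 1 1 0 (nabla Ws)).
{ apply (symb_le 1 1 2 1 0 0); try lia. apply symb_nabla, symb_Ws. }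
unfold Ys, Gs. rewrite tail_sub.
- rewrite (tail_of_nabla (nabla Ws)) by apply (L _ _ HnW). fold Bs.
  replace (Bs - - nabla Ws)%fps with (Bs - nabla (- Ws))%fps by (unfold nabla; ring).
  rewrite tail_sub, tail_of_nabla.
  + fold Ts. ring.
  + apply (L 0%nat), symb_opp, symb_Ws.
  + apply ex_series_Bs.
  + apply dominated_ex_series, (symb_dominated 0), symb_nabla, symb_opp, symb_Ws.
- apply ex_series_ipow.
- apply dominated_ex_series, (symb_dominated 0), symb_nabla. exact HnW.
Qed.

(** The expansion at [z = 1] is [T = T0 + (1 - z) T1 + (1 - z)^2 Qs], where [hl] is the logarithm
    and [m2], [- m3] are the constants; [T'] collects everything after [T0]. *)
Definition T0 : nat -> R := (cst m2 + hl)%fps.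
Definition T1 : nat -> R := (hl - cst m3)%fps.
Definition Qs : nat -> R := (tail (tail Ys) + cst (11 / 24) * ipow 1)%fps.
Definition T' : nat -> R := (T1 + nabla Qs)%fps.

Lemma Ts_expansion : Ts = (T0 + nabla T')%fps.
Proof.
destruct symb_tail_Gs as [H1 [H2 H3]].
assert (E1 : nabla (tail Ys) = (cst m2 - Ys)%fps).
{ rewrite <- Series_Ys. apply nabla_tail, dominated_ex_series.
  apply (dominated_le 4 2 0 0); try lia. apply (symb_dominated 2), H2. }
assert (E2 : nabla (tail (tail Ys)) = (cst m3 - tail Ys)%fps).
{ rewrite <- Series_tail_Ys. apply nabla_tail, dominated_ex_series.
  apply (dominated_le 3 2 0 0); try lia. apply (symb_dominated 3), H3. }
transitivity (cst m2 - nabla (tail Ys) + Ws)%fps; [rewrite E1, Ys_eq; ring|].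
replace (tail Ys) with (cst m3 - nabla (tail (tail Ys)))%fps by (rewrite E2; ring).
unfold T0, T', T1, Qs, Ws, nabla. ring.
Qed.

Lemma symb_T0 (N : nat) : symb N 1 0 T0.
Proof. apply symb_add; [apply symb_const | apply symb_hl]. Qed.

Lemma symb_Qs : symb 4 1 0 Qs.
Proof.
destruct symb_tail_Gs as [H1 [H2 H3]]. apply symb_add.
- apply (symb_le 4 4 2 1 0 0); try lia. apply (symb_tail 3 1), H3.
- apply symb_cst, symb_ipow.
Qed.

Lemma symb_T' : symb 3 1 0 T'.
Proof.
apply symb_add.
- apply symb_sub; [apply symb_hl | apply symb_const].
- apply (symb_le 3 3 2 1 0 0); try lia. apply symb_nabla, symb_Qs.
Qed.

(** Only [T^2] modulo [(1 - z)^2] and [T^3] modulo [1 - z] matter, since they already carry one and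
    two differences; [T] itself is replaced by [Ws] with error [Ys] of order 4. *)
Lemma Us_main : dominated 4 3
  (cst z2 * cst z2 * cst z2 * cst z2 * Us
   - (cst z2 * cst z2 * cst z2 * ones + cst z2 * cst z2 * Ws
      + cst z2 * ((f1 + f1) * cst m2 * nabla hl + nabla (hl * hl)
                  + (f1 + f1) * nabla (nabla (cst m2 * hl - cst m3 * hl + hl * hl)))
      + nabla (nabla ((f1 + f1 + f1) * cst m2 * cst m2 * hl
                      + (f1 + f1 + f1) * cst m2 * hl * hl + hl * hl * hl))))%fps.
Proof.
pose proof symb_T' as HT'. pose proof (symb_Ts 3) as HT. pose proof (symb_T0 3) as HT0.
pose proof (symb_Vs 3) as HV.
assert (HQ : symb 3 1 0 Qs) by (apply (symb_le 4 3 1 1 0 0); try lia; apply symb_Qs).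
(* All terms divisible by [(1 - z)^3]: the rest of [T^2], the rest of [T^3] factored as a difference
   of cubes, and the term with [V]. *)
set (X := (cst z2 * ((f1 + f1) * (T0 * Qs) + T' * T')
           + (T' * (Ts * Ts + Ts * T0 + T0 * T0) + Ts * Ts * Ts * Ts * Vs))%fps).
assert (HX : symb 3 1 3 X).
{ assert (P1 : forall x y, symb 3 1 0 x -> symb 3 1 0 y -> symb 3 1 1 (x * y)%fps)
    by (intros x y Hx Hy; apply (symb_mul_11 3 0 0); assumption).
  assert (P2 : forall x y, symb 3 1 0 x -> symb 3 1 1 y -> symb 3 1 2 (x * y)%fps)
    by (intros x y Hx Hy; apply (symb_mul_11 3 0 1); assumption).
  assert (P3 : forall x y, symb 3 1 1 x -> symb 3 1 1 y -> symb 3 1 3 (x * y)%fps)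
    by (intros x y Hx Hy; apply (symb_mul_11 3 1 1); assumption).
  apply symb_add; [|apply symb_add].
  - apply (symb_le 3 3 1 1 1 3); try lia. apply symb_cst, symb_add.
    + replace ((f1 + f1) * (T0 * Qs))%fps with (T0 * Qs + T0 * Qs)%fps by ring.
      apply symb_add; auto.
    + auto.
  - apply (symb_le 3 3 1 1 2 3); try lia. apply P2; [assumption|].
    repeat apply symb_add; auto.
  - apply symb_mul_12; [|assumption].
    replace (Ts * Ts * Ts * Ts)%fps with ((Ts * Ts) * (Ts * Ts))%fps by ring. auto. }
(* The constants of [T0^2], [T0 * T1] and [T0^3] yield polynomials of degree at most 2 in [z],
   invisible from index 3 on. *)
set (Z := (cst z2 * (nabla (cst m2 * cst m2) - (f1 + f1) * nabla (nabla (cst m2 * cst m3)))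
           + nabla (nabla (cst m2 * cst m2 * cst m2)))%fps).
match goal with |- dominated _ _ ?e =>
  replace e with (cst z2 * (cst z2 * Ys) + (iter_nabla 3 X + Z))%fps end.
- apply dominated_add; [|apply dominated_add].
  + do 2 apply dominated_cst. apply (dominated_le 4 4 0 3); try lia.
    apply (symb_dominated 2), symb_tail_Gs.
  + apply (HX 3%nat); lia.
  + assert (HC : forall c x, symb 2 2 3 x -> symb 2 2 3 (cst c * x)%fps)
      by (intros; apply symb_cst; assumption).
    assert (F : forall x : nat -> R, (forall n, (1 <= n)%nat -> x n = 0) ->
      forall n, (3 <= n)%nat -> nabla x n = 0 /\ nabla (nabla x) n = 0).
    { intros x Hx n Hn. split.
      - apply (iter_nabla_finite 1 1 x Hx); lia.
      - apply (iter_nabla_finite 2 1 x Hx); lia. }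
    assert (K : forall c (n : nat), (1 <= n)%nat -> cst c n = 0).
    { intros c [|n] Hn; [lia|]. unfold cst, delta; simpl; ring. }
    assert (KM : forall c x, (forall n : nat, (1 <= n)%nat -> x n = 0) ->
      forall n, (1 <= n)%nat -> (cst c * x)%fps n = 0).
    { intros c x Hx n Hn. rewrite conv_cst, Hx by assumption. ring. }
    apply (dominated_finite 3). intros n Hn. unfold Z.
    replace ((f1 + f1) * nabla (nabla (cst m2 * cst m3)))%fps
      with (nabla (nabla (cst m2 * cst m3)) + nabla (nabla (cst m2 * cst m3)))%fps by ring.
    unfold fadd at 1. rewrite conv_cst. unfold fsub, fadd.
    rewrite (proj1 (F (cst m2 * cst m2)%fps ltac:(auto) n Hn)).
    rewrite (proj2 (F (cst m2 * cst m3)%fps ltac:(auto) n Hn)).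
    replace (cst m2 * cst m2 * cst m2)%fps with (cst m2 * (cst m2 * cst m2))%fps by ring.
    rewrite (proj2 (F (cst m2 * (cst m2 * cst m2))%fps ltac:(auto) n Hn)). ring.
- rewrite Us_expansion, Ys_eq. unfold X, Z. simpl Nat.iter.
  set (V := Vs). set (T := Ts).
  assert (ET : T = (T0 + nabla T')%fps) by apply Ts_expansion.
  transitivity (cst z2 * (cst z2 * (T - Ws))
    + cst z2 * (nabla (T * T) - nabla (T0 * T0) - (f1 + f1) * nabla (nabla (T0 * T1)))
    + (nabla (nabla (T * T * T)) - nabla (nabla (T0 * T0 * T0)))
    + iter_nabla 3 (T * T * T * T * V) + Z)%fps.
  + unfold Z. rewrite ET. unfold T', nabla. simpl Nat.iter. unfold nabla. ring.
  + unfold Z, T0, T1, nabla. simpl Nat.iter. unfold nabla. ring.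
Qed.

(** * Harmonic numbers *)

(** The usual harmonic number, because [ipow 1 0 = 0]; [harm n] is the next one ([Hn_harm]). *)
Definition Hn (n : nat) : R := sum_f_R0 (ipow 1) n.
Definition H2n (n : nat) : R := sum_f_R0 (ipow 2) n.

Lemma Hn_S (n : nat) : Hn (S n) = Hn n + / (INR n + 1).
Proof. unfold Hn. rewrite tech5. unfold ipow. rewrite pow_1, S_INR. reflexivity. Qed.

Lemma H2n_S (n : nat) : H2n (S n) = H2n n + / (INR n + 1) ^ 2.
Proof. unfold H2n. rewrite tech5. unfold ipow. rewrite S_INR. reflexivity. Qed.

(** The derivative is half the square of [t/(1+t)], so the mean value theorem gives sign and size at
    once. For [t = 1/k] this is the error of the trapezoidal rule for [1/x] between [k] and
    [k + 1]. *)
Lemma trapezoid_log (t : R) : 0 <= t ->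
  0 <= / 2 * (t + t / (1 + t)) - ln (1 + t) <= t ^ 3 / 2.
Proof.
intro Ht.
destruct (MVT_gen (fun t => / 2 * (t + t / (1 + t)) - ln (1 + t)) 0 t
  (fun c => / 2 * (c / (1 + c)) ^ 2)) as [c [Hc E]].
- rewrite Rmin_left, Rmax_right by lra. intros x Hx.
  auto_derive; [repeat split; lra|]. field; lra.
- rewrite Rmin_left, Rmax_right by lra. intros x Hx.
  apply (continuity_pt_filterlim (fun t => / 2 * (t + t / (1 + t)) - ln (1 + t))).
  apply (ex_derive_continuous (fun t => / 2 * (t + t / (1 + t)) - ln (1 + t))).
  auto_derive. repeat split; lra.
- rewrite Rmin_left, Rmax_right in Hc by lra.
  rewrite Rplus_0_r, ln_1 in E.
  replace (/ 2 * (t + t / (1 + t)) - ln (1 + t)) with (/ 2 * (c / (1 + c)) ^ 2 * (t - 0))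
    by (rewrite <- E; field; lra).
  assert (0 <= c / (1 + c) <= t).
  { split; [apply Rdiv_le_0_compat; lra|]. apply Rle_trans with c; [|lra].
    apply Rmult_le_reg_r with (1 + c); [lra|]. unfold Rdiv.
    rewrite Rmult_assoc, Rinv_l by lra. nra. }
  assert ((c / (1 + c)) ^ 2 <= t ^ 2) by (apply pow_incr; lra).
  pose proof (pow2_ge_0 (c / (1 + c))). split; [nra|]. simpl; simpl in *. nra.
Qed.

Definition harm_defect (m : nat) : R :=
  Hn (S m) - ln (INR m + 1) - / (2 * (INR m + 1)).

Lemma harm_defect_step (m : nat) :
  0 <= harm_defect (S m) - harm_defect m <= (/ (INR m + 1)) ^ 3 / 2.
Proof.
pose proof (INR1_pos m) as Hm.
assert (Ht : 0 <= / (INR m + 1)) by (left; apply Rinv_0_lt_compat, Hm).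
assert (H := trapezoid_log _ Ht).
replace (harm_defect (S m) - harm_defect m) with
  (/ 2 * (/ (INR m + 1) + / (INR m + 1) / (1 + / (INR m + 1))) - ln (1 + / (INR m + 1)));
  [exact H|].
unfold harm_defect. rewrite (Hn_S (S m)), !S_INR.
replace (INR m + 1 + 1) with ((INR m + 1) * (1 + / (INR m + 1))) at 2 by (field; lra).
rewrite ln_mult by lra. field. lra.
Qed.

(** The defect increases and the defect plus [1/(m+1)^2] decreases, by [harm_defect_step]; both tend
    to [euler_gamma], which is therefore enclosed. *)
Lemma harm_defect_bounds (m : nat) :
  harm_defect m <= euler_gamma <= harm_defect m + (/ (INR m + 1)) ^ 2.
Proof.
assert (Hi : forall n, harm_defect n <= harm_defect (S n))
  by (intro n; pose proof (harm_defect_step n); lra).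
assert (Hd : forall n, harm_defect (S n) + (/ (INR (S n) + 1)) ^ 2
                       <= harm_defect n + (/ (INR n + 1)) ^ 2).
{ intro n. pose proof (harm_defect_step n) as Hs. pose proof (pos_INR n).
  rewrite S_INR. set (x := INR n) in *.
  enough (0 <= (/ (x + 1)) ^ 2 - (/ (x + 1 + 1)) ^ 2 - (/ (x + 1)) ^ 3 / 2) by lra.
  replace (_ - _) with ((2 * (2 * x + 3) * (x + 1) - (x + 2) ^ 2)
     / (2 * (x + 1) ^ 3 * (x + 2) ^ 2)) by (field; lra).
  apply Rdiv_le_0_compat; [nra|].
  repeat apply Rmult_lt_0_compat; try apply pow_lt; lra. }
assert (Hb : forall n, harm_defect n <= harm_defect 0 + (/ (INR 0 + 1)) ^ 2).
{ intro n. apply Rle_trans with (harm_defect n + (/ (INR n + 1)) ^ 2).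
  - pose proof (pow2_ge_0 (/ (INR n + 1))). lra.
  - induction n as [|n IH]; [lra|]. eapply Rle_trans; [apply Hd|exact IH]. }
destruct (ex_finite_lim_seq_incr _ _ Hi Hb) as [g Hg].
assert (Hinv := is_lim_seq_inv_shift 0). simpl in Hinv.
assert (Eg : euler_gamma = g).
{ unfold euler_gamma.
  enough (L : is_lim_seq (fun n => sum_n_m (fun k => / INR k) 1 n - ln (INR n)) g)
    by (rewrite (is_lim_seq_unique _ _ L); reflexivity).
  apply is_lim_seq_incr_1.
  apply (is_lim_seq_ext (fun n => harm_defect n + / 2 * / (INR n + 1))).
  - intro n. unfold harm_defect. rewrite S_INR.
    replace (sum_n_m (fun k => / INR k) 1 (S n)) with (Hn (S n)).
    + field. apply Rgt_not_eq, INR1_pos.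
    + induction n as [|n IH].
      * rewrite sum_n_n. unfold Hn; simpl. field.
      * rewrite sum_n_Sm, <- IH, Hn_S by lia. rewrite (S_INR (S n)). reflexivity.
  - replace (Finite g) with (Finite (g + / 2 * 0)) by (f_equal; ring).
    apply is_lim_seq_plus'; [assumption|].
    apply (is_lim_seq_scal_l _ (/ 2) 0). exact Hinv. }
rewrite Eg. split.
- apply (is_lim_seq_incr_compare _ _ Hg Hi).
- apply (is_lim_seq_decr_compare (fun n => harm_defect n + (/ (INR n + 1)) ^ 2)).
  + replace (Finite g) with (Finite (g + 0)) by (f_equal; ring).
    apply is_lim_seq_plus'; [assumption|].
    apply (is_lim_seq_ext (fun n => / (INR n + 1) * / (INR n + 1))).
    * intro n. simpl. ring.
    * replace (Finite 0) with (Finite (0 * 0)) by (f_equal; ring).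
      apply is_lim_seq_mult'; assumption.
  + exact Hd.
Qed.

(** Multiplication by [z/(1 - z)] takes partial sums, delayed by one index. *)
Lemma ipow0_conv (x : nat -> R) (n : nat) : (ipow 0 * x)%fps (S n) = sum_f_R0 x n.
Proof.
rewrite conv_sym, conv_sum, tech5, Nat.sub_diag. simpl (ipow 0 0).
rewrite Rmult_0_r, Rplus_0_r. apply sum_eq. intros k Hk.
replace (S n - k)%nat with (S (n - k)) by lia. unfold ipow. rewrite pow_O. field.
Qed.

Lemma hl_n (n : nat) : hl n = 1 / 2 * ipow 1 n.
Proof. apply conv_cst. Qed.

Lemma theta_hl : theta hl = (cst (1 / 2) * ipow 0)%fps.
Proof.
rewrite <- theta_ipow. apply functional_extensionality; intro n.
rewrite conv_cst. unfold theta. rewrite hl_n. ring.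
Qed.

Lemma theta_eq (x : nat -> R) (n : nat) (v : R) :
  theta x (S n) = v -> x (S n) = v / (INR n + 1).
Proof.
unfold theta. rewrite S_INR. intros <-. field. apply Rgt_not_eq, INR1_pos.
Qed.

(** Since [theta hl] is [z/(1 - z)] up to a factor [1/2], the Euler operator reduces a power of the
    logarithm to partial sums of the preceding power. The cube is treated likewise. *)
Lemma hl2_n (n : nat) : (hl * hl)%fps (S n) = Hn n / 2 / (INR n + 1).
Proof.
apply theta_eq. rewrite theta_mul, theta_hl. unfold fadd.
rewrite (conv_sym _ hl).
replace ((cst (1 / 2) * ipow 0 * hl)%fps) with (cst (1 / 2) * (ipow 0 * hl))%fps by ring.
rewrite conv_cst, ipow0_conv. unfold hl.
rewrite (sum_eq _ (fun k => ipow 1 k * (1 / 2))) by (intros; rewrite conv_cst; ring).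
rewrite <- scal_sum. unfold Hn. field.
Qed.

Lemma hl3_n (n : nat) :
  (hl * hl * hl)%fps (S n) = 3 / 8 * (Hn n ^ 2 - H2n n) / (INR n + 1).
Proof.
apply theta_eq. rewrite theta_mul, theta_mul, theta_hl.
replace ((cst (1 / 2) * ipow 0 * hl + hl * (cst (1 / 2) * ipow 0)) * hl
    + hl * hl * (cst (1 / 2) * ipow 0))%fps
  with (cst (1 / 2) * (ipow 0 * (hl * hl)) + cst (1 / 2) * (ipow 0 * (hl * hl))
        + cst (1 / 2) * (ipow 0 * (hl * hl)))%fps by ring.
unfold fadd. rewrite conv_cst, ipow0_conv.
(* The sum of [1/(j k)] over [j < k <= n] is half the difference between the squared harmonic number
   and the sum of squares. *)
assert (E : sum_f_R0 (hl * hl)%fps n = / 4 * (Hn n ^ 2 - H2n n)).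
{ induction n as [|n IH].
  - unfold Hn, H2n, hl, cst, delta; simpl. ring.
  - rewrite tech5, IH, hl2_n, Hn_S, H2n_S. field. apply Rgt_not_eq, INR1_pos. }
rewrite E. field.
Qed.

(** * Asymptotics of the coefficients *)

Lemma dominated_eq_from (n0 s p : nat) (x y : nat -> R) :
  (forall n, (n0 <= n)%nat -> x n = y n) -> dominated s p y -> dominated s p x.
Proof.
intros E [K [_ H]]. apply (dominated_eventually n0 s p x K).
intros n Hn. rewrite E by assumption. apply H.
Qed.

Lemma dominated_plus (s p : nat) (x y : nat -> R) :
  dominated s p x -> dominated s p y -> dominated s p (fun n => x n + y n).
Proof. apply dominated_add. Qed.

Lemma dominated_scal (s p : nat) (c : R) (x : nat -> R) :
  dominated s p x -> dominated s p (fun n => c * x n).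
Proof.
intro H. apply (dominated_eq_from 0 _ _ _ (cst c * x)%fps).
- intros n _. rewrite conv_cst. reflexivity.
- apply dominated_cst, H.
Qed.

Lemma dominated_minus (s p : nat) (x y : nat -> R) :
  dominated s p x -> dominated s p y -> dominated s p (fun n => x n - y n).
Proof.
intros Hx Hy. apply (dominated_eq_from 0 _ _ _ (fun n => x n + (-1) * y n)).
- intros; ring.
- apply dominated_plus; [|apply dominated_scal]; assumption.
Qed.

Lemma dominated_mult (s p s' p' : nat) (x y : nat -> R) :
  dominated s p x -> dominated s' p' y ->
  dominated (s + s') (p + p') (fun n => x n * y n).
Proof.
intros [K [HK Hx]] [K' [HK' Hy]]. exists (K * K'); split.
- apply Rmult_le_pos; assumption.
- intro n. rewrite Rabs_mult.
  replace (K * K' * weight (s + s') (p + p') n)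
    with (K * weight s p n * (K' * weight s' p' n)).
  + apply Rmult_le_compat; auto using Rabs_pos.
  + unfold weight. rewrite !pow_add. pose proof (INR1_pos n).
    field. split; apply pow_nonzero; lra.
Qed.

Lemma dominated_inv_shift (c : R) : dominated 1 0 (fun n => / (INR n - c)).
Proof.
(* Beyond this threshold [n - c >= (n + 1)/2]; a possible pole [n = c] lies among the finitely many
   indices before it. *)
destruct (INR_unbounded (2 * Rabs c + 1)) as [n0 Hn0].
apply (dominated_eventually n0 1 0 _ 4). intros n Hn.
apply le_INR in Hn. pose proof (Rle_abs c). pose proof (Rabs_pos c).
unfold weight. rewrite pow_O, pow_1.
rewrite Rabs_pos_eq by (left; apply Rinv_0_lt_compat; lra).
replace (4 * (1 / (INR n + 1))) with (/ ((INR n + 1) / 4)) by (field; lra).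
apply Rinv_le_contravar; lra.
Qed.

(** Variables of the final expansion. The main terms use [Xn] and [lam] only; [Yn] and [Wn] come
    from the shifts made by the differences, [mu] is [- 1/(2 n)] to leading order, [del] is [mu]
    without that term, and [eta] is a tail of [zeta(2)]. *)
Definition Xn (n : nat) : R := / INR n.
Definition Yn (n : nat) : R := / (INR n - 1).
Definition Wn (n : nat) : R := / (INR n - 2).
Definition hn (n : nat) : R := Hn (n - 1).
Definition qn (n : nat) : R := H2n (n - 1).
Definition lam (n : nat) : R := ln (INR n) + euler_gamma.
Definition mu (n : nat) : R := hn n - lam n.
Definition del (n : nat) : R := mu n + / 2 * Xn n.
Definition eta (n : nat) : R := z2 - qn n.

Lemma dominated_Xn : dominated 1 0 Xn.
Proof.
apply (dominated_eq_from 0 _ _ _ (fun n => / (INR n - 0))).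
- intros n _. unfold Xn. rewrite Rminus_0_r. reflexivity.
- apply dominated_inv_shift.
Qed.

(** Because [hn n] stops at [1/(n-1)], adding [1/(2 n)] to it is the same as removing [1/(2 n)] from
    the full harmonic number: [del] is [harm_defect] minus its limit. *)
Lemma dominated_del : dominated 2 0 del.
Proof.
apply (dominated_eventually 1 _ _ _ 4). intros [|m] Hm; [lia|].
pose proof (INR1_pos m). pose proof (pos_INR m).
assert (B := harm_defect_bounds m). unfold harm_defect in B. rewrite Hn_S in B.
unfold del, mu, hn, lam, Xn. replace (S m - 1)%nat with m by lia.
unfold weight. rewrite S_INR. rewrite pow_O. set (x := INR m) in *.
replace (/ (2 * (x + 1))) with (/ (x + 1) - / 2 * / (x + 1)) in B by (field; lra).
apply Rle_trans with ((/ (x + 1)) ^ 2).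
- apply Rabs_le. lra.
- replace (4 * (1 / (x + 1 + 1) ^ 2)) with ((/ ((x + 2) / 2)) ^ 2) by (field; lra).
  apply pow_incr. split; [left; apply Rinv_0_lt_compat; lra|].
  apply Rinv_le_contravar; lra.
Qed.

Lemma dominated_mu : dominated 1 0 mu.
Proof.
apply (dominated_eq_from 0 _ _ _ (fun n => del n - / 2 * Xn n)).
- intros n _. unfold del. ring.
- apply dominated_minus.
  + apply (dominated_le 2 1 0 0); auto using dominated_del.
  + apply dominated_scal, dominated_Xn.
Qed.

Lemma Hn_harm (n : nat) : Hn (S n) = harm n.
Proof.
induction n as [|n IH].
- unfold Hn, harm; simpl. field.
- rewrite Hn_S, harm_S, IH, S_INR. f_equal. f_equal. ring.
Qed.

Lemma dominated_hn : dominated 0 1 hn.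
Proof.
apply (dominated_eventually 2 _ _ _ 1). intros n Hn'. unfold hn.
replace (n - 1)%nat with (S (n - 2)) by lia. rewrite Hn_harm.
pose proof (harm_ge1 (n - 2)). rewrite Rabs_pos_eq by lra.
unfold weight. simpl. assert (H1 := harm_mono (n - 2) n ltac:(lia)). lra.
Qed.

Lemma dominated_lam : dominated 0 1 lam.
Proof.
apply (dominated_eq_from 0 _ _ _ (fun n => hn n - mu n)).
- intros n _. unfold mu. ring.
- apply dominated_minus; [apply dominated_hn|].
  apply (dominated_le 1 0 0 1); auto using dominated_mu.
Qed.

Lemma dominated_eta : dominated 1 0 eta.
Proof.
apply (dominated_eq_from 1 _ _ _ (delta 1 * tail (ipow 2))%fps).
- intros [|n] Hn; [lia|]. rewrite conv_delta. simpl Nat.leb. cbv iota.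
  replace (S n - 1)%nat with n by lia. unfold eta, qn. replace (S n - 1)%nat with n by lia.
  clear Hn. induction n as [|n IH].
  + unfold H2n, z2, tail. simpl sum_f_R0. rewrite Series_incr_1 by apply (ex_series_ipow 0).
    simpl. ring.
  + rewrite H2n_S. rewrite (tail_step _ n (ex_series_ipow 0)) in IH.
    unfold ipow at 1 in IH. rewrite S_INR in IH. lra.
- apply dominated_shift, (dominated_tail 0), (symb_dominated 0), symb_ipow.
Qed.

Lemma dominated_const (c : R) : dominated 0 0 (fun _ => c).
Proof.
exists (Rabs c). split; [apply Rabs_pos|]. intro n. unfold weight; simpl. lra.
Qed.

(** Order counting: the order of a monomial is inferred by unification from its factors and then
    compared with the required one by [lia]. Sums are split only at the top, so products must be
    expanded beforehand. *)
Ltac dom_base :=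
  first [ exact dominated_Xn | exact (dominated_inv_shift 1) | exact (dominated_inv_shift 2)
        | exact dominated_mu | exact dominated_del | exact dominated_eta
        | exact dominated_lam | exact dominated_hn | apply dominated_const ].
Ltac dom_mono := first [ dom_base | eapply dominated_mult; [dom_mono | dom_mono] ].
Ltac dom_term := eapply dominated_le; [ | | dom_mono ]; simpl; lia.
Ltac dom :=
  lazymatch goal with
  | |- dominated _ _ (fun n => _ + _) => apply dominated_plus; dom
  | |- dominated _ _ (fun n => _ - _) => apply dominated_minus; dom
  | _ => dom_term
  end.

(* [rho = X Y W - X^3] with [Y = X + X Y] and [W = X + 2 X W]. *)
Definition rho (n : nat) : R :=
  2 * (Xn n * Xn n * Xn n * Wn n) + Xn n * Xn n * Xn n * Yn n
  + 2 * (Xn n * Xn n * Xn n * (Yn n * Wn n)).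

Lemma dominated_rho : dominated 4 0 rho.
Proof. unfold rho. dom. Qed.

(** Exact remainders, written so that every monomial visibly has order 4 and at most two factors
    [lam]. The identities below then hold without error terms; for the second difference of [hl] the
    remainder is [rho] itself. *)
Definition rem1 (n : nat) : R :=
  11 / 12 * rho n - 1 / 2 * (Xn n * Xn n * Xn n * Yn n).
Definition rem2 (n : nat) : R := - (1 / 2) * (Xn n * Xn n * Xn n * Yn n).
Definition rem3 (n : nat) : R :=
  5 / 4 * (Xn n * Xn n * Xn n * Yn n) + 1 / 2 * (Xn n * Xn n * (Yn n * Yn n))
  - 1 / 2 * (lam n * (Xn n * Xn n * Xn n * Yn n)) - 1 / 2 * (del n * (Xn n * Yn n)).
Definition rem5 (n : nat) : R :=
  lam n * rho n + mu n * (Xn n * Yn n * Wn n) - Xn n * (Yn n * Yn n * Wn n)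
  - 3 / 2 * rho n - Xn n * (Wn n * Yn n * Wn n).
Definition rem6 (n : nat) : R :=
  3 / 8 * (2 * (lam n * lam n * rho n) - 2 * z2 * rho n
    + 2 * (mu n * (2 * (lam n * (Xn n * Yn n * Wn n)) + mu n * (Xn n * Yn n * Wn n)))
    + 2 * (eta n * (Xn n * Yn n * Wn n))
    - 2 * (lam n * (2 * (Xn n * Yn n * Yn n * Wn n) + 3 * rho n + 2 * (Xn n * Wn n * Yn n * Wn n)))
    - 2 * (mu n * (2 * (Yn n * Yn n * Wn n) + Yn n * Wn n * Wn n))
    - 4 * (Xn n * Yn n * (Yn n * Yn n + Xn n * Yn n + Xn n * Xn n))
    + 2 * (Xn n * Yn n * Yn n * Wn n) + 4 * rho n + 4 * (Xn n * Wn n * Yn n * Wn n)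
    + 4 * (Xn n * Wn n * (Wn n * Wn n + Xn n * Wn n + Xn n * Xn n))).

(** From index 3 on, two backward differences stay at positive indices, so this and the next
    identities are purely rational and fall to [field]. *)
Lemma Ws_n (n : nat) : (3 <= n)%nat ->
  Ws n = 1 / 2 * Xn n - 1 / 2 * Xn n ^ 2 + 5 / 12 * Xn n ^ 3 + rem1 n.
Proof.
intro Hn. destruct n as [|[|[|m]]]; try lia. clear Hn.
unfold Ws, fadd. rewrite conv_cst, !nabla_S, !hl_n.
unfold rem1, rho, Xn, Yn, Wn, ipow. rewrite !S_INR. pose proof (pos_INR m). field. lra.
Qed.

Lemma nabla_hl_n (n : nat) : (3 <= n)%nat ->
  nabla hl n = - (1 / 2) * (Xn n ^ 2 + Xn n ^ 3) + rem2 n.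
Proof.
intro Hn. destruct n as [|[|[|m]]]; try lia. clear Hn.
rewrite !nabla_S, !hl_n.
unfold rem2, Xn, Yn, ipow. rewrite !S_INR. pose proof (pos_INR m). field. lra.
Qed.

Lemma nabla2_hl_n (n : nat) : (3 <= n)%nat ->
  nabla (nabla hl) n = Xn n ^ 3 + rho n.
Proof.
intro Hn. destruct n as [|[|[|m]]]; try lia. clear Hn.
rewrite !nabla_S, !hl_n.
unfold rho, Xn, Yn, Wn, ipow. rewrite !S_INR. pose proof (pos_INR m). field. lra.
Qed.

Lemma nabla_hl2_n (n : nat) : (3 <= n)%nat ->
  nabla (hl * hl)%fps n
  = 1 / 2 * ((1 - lam n) * Xn n ^ 2 + (5 / 2 - lam n) * Xn n ^ 3) + rem3 n.
Proof.
intro Hn. destruct n as [|[|[|m]]]; try lia. clear Hn.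
rewrite !nabla_S, !hl2_n. unfold rem3, del, mu, hn. replace (S (S (S m)) - 1)%nat with (S (S m)) by lia.
rewrite (Hn_S (S m)). set (L := lam _). set (H := Hn (S m)).
unfold Xn, Yn. rewrite !S_INR. pose proof (pos_INR m). field. lra.
Qed.

Lemma nabla2_hl2_n (n : nat) : (3 <= n)%nat ->
  nabla (nabla (hl * hl)%fps) n = (lam n - 3 / 2) * Xn n ^ 3 + rem5 n.
Proof.
intro Hn. destruct n as [|[|[|m]]]; try lia. clear Hn.
rewrite !nabla_S, !hl2_n. unfold rem5, rho, mu, hn. replace (S (S (S m)) - 1)%nat with (S (S m)) by lia.
rewrite (Hn_S (S m)), (Hn_S m). set (L := lam _). set (H := Hn m).
unfold Xn, Yn, Wn. rewrite !S_INR. pose proof (pos_INR m). field. lra.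
Qed.

Lemma nabla2_hl3_n (n : nat) : (3 <= n)%nat ->
  nabla (nabla (hl * hl * hl)%fps) n
  = 3 / 8 * (2 * lam n ^ 2 - 6 * lam n + 2 - 2 * z2) * Xn n ^ 3 + rem6 n.
Proof.
intro Hn. destruct n as [|[|[|m]]]; try lia. clear Hn.
rewrite !nabla_S, !hl3_n. unfold rem6, rho, mu, eta, hn, qn.
replace (S (S (S m)) - 1)%nat with (S (S m)) by lia.
rewrite (Hn_S (S m)), (Hn_S m), (H2n_S (S m)), (H2n_S m).
set (L := lam _). set (H := Hn m). set (H2 := H2n m). set (z := z2).
unfold Xn, Yn, Wn. rewrite !S_INR. pose proof (pos_INR m). field. lra.
Qed.

(** The expansion sought, multiplied by [zeta(2)^4 / zeta(3)] and written with [z2] in place of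
    [PI ^ 2 / 6]. *)
Definition Us_target (n : nat) : R :=
  z2 ^ 3 + z2 ^ 2 / 2 * Xn n - z2 * (1 / 4 + lam n / 2) * Xn n ^ 2
  + (3 / 4 * lam n ^ 2 - 7 / 12 * z2 - 15 / 16) * Xn n ^ 3.

Lemma dominated_rems : dominated 4 3 rem1 /\ dominated 4 3 rem2 /\ dominated 4 3 rem3
  /\ dominated 4 3 rho /\ dominated 4 3 rem5 /\ dominated 4 3 rem6.
Proof.
pose proof dominated_rho as HR.
assert (HR' : dominated 4 3 rho) by (apply (dominated_le 4 4 0 3); auto with arith).
assert (HL : dominated 4 3 (fun n => lam n * rho n)).
{ apply (dominated_le 4 4 1 3); auto with arith.
  apply (dominated_mult 0 1 4 0); [exact dominated_lam | exact HR]. }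
assert (HL2 : dominated 4 3 (fun n => lam n * lam n * rho n)).
{ apply (dominated_le 4 4 2 3); auto with arith.
  apply (dominated_mult 0 2 4 0); [|exact HR].
  apply (dominated_mult 0 1 0 1); exact dominated_lam. }
split; [|split; [|split; [|split; [assumption|split]]]].
- unfold rem1. apply dominated_minus; [apply dominated_scal; assumption | dom].
- unfold rem2. dom.
- unfold rem3. dom.
- unfold rem5. repeat apply dominated_minus; try (apply dominated_scal; assumption);
    [|dom|dom]. apply dominated_plus; [assumption|dom].
(* The multiples of [rho] are separated from the monomials, since order counting does not look
   inside [rho]. *)
- apply (dominated_eq_from 0 _ _ _ (fun n => 3 / 8 * (
    2 * (lam n * lam n * rho n) + (4 - 2 * z2) * rho n - 6 * (lam n * rho n)
    + (4 * (mu n * (lam n * (Xn n * Yn n * Wn n)))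
    + 2 * (mu n * (mu n * (Xn n * Yn n * Wn n)))
    + 2 * (eta n * (Xn n * Yn n * Wn n))
    - 4 * (lam n * (Xn n * Yn n * Yn n * Wn n)) - 4 * (lam n * (Xn n * Wn n * Yn n * Wn n))
    - 4 * (mu n * (Yn n * Yn n * Wn n)) - 2 * (mu n * (Yn n * Wn n * Wn n))
    - 4 * (Xn n * Yn n * (Yn n * Yn n)) - 4 * (Xn n * Yn n * (Xn n * Yn n))
    - 4 * (Xn n * Yn n * (Xn n * Xn n))
    + 2 * (Xn n * Yn n * Yn n * Wn n) + 4 * (Xn n * Wn n * Yn n * Wn n)
    + 4 * (Xn n * Wn n * (Wn n * Wn n)) + 4 * (Xn n * Wn n * (Xn n * Wn n))
    + 4 * (Xn n * Wn n * (Xn n * Xn n)))))).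
  + intros n _. unfold rem6. ring.
  + apply dominated_scal, dominated_plus.
    * apply dominated_minus; [apply dominated_plus|]; apply dominated_scal; assumption.
    * dom.
Qed.

Lemma Us_asymptotics : dominated 4 3 (fun n => z2 ^ 4 * Us n - Us_target n).
Proof.
destruct dominated_rems as [R1 [R2 [R3 [R4 [R5 R6]]]]].
match type of Us_main with dominated _ _ ?e => set (E := e) end.
apply (dominated_eq_from 3 _ _ _ (fun n => E n + (z2 ^ 2 * rem1 n + 2 * z2 * m2 * rem2 n
  + z2 * rem3 n + (2 * z2 * (m2 - m3) + 3 * m2 ^ 2) * rho n
  + (2 * z2 + 3 * m2) * rem5 n + rem6 n))).
- intros n Hn. unfold E.
  (* [conv_cst] evaluates only a leading constant series, so constants are moved to the front and
     the factors 2 and 3 are written as repeated sums. *)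
  match goal with |- _ = ?e n + _ => replace e with
    (cst z2 * (cst z2 * (cst z2 * (cst z2 * Us)))
     - (cst z2 * (cst z2 * (cst z2 * ones)) + cst z2 * (cst z2 * Ws)
        + cst z2 * (cst m2 * nabla hl + cst m2 * nabla hl + nabla (hl * hl)
             + (cst m2 * nabla (nabla hl) - cst m3 * nabla (nabla hl) + nabla (nabla (hl * hl)))
             + (cst m2 * nabla (nabla hl) - cst m3 * nabla (nabla hl) + nabla (nabla (hl * hl))))
        + (cst m2 * (cst m2 * nabla (nabla hl)) + cst m2 * (cst m2 * nabla (nabla hl))
           + cst m2 * (cst m2 * nabla (nabla hl))
           + cst m2 * nabla (nabla (hl * hl)) + cst m2 * nabla (nabla (hl * hl))
           + cst m2 * nabla (nabla (hl * hl)) + nabla (nabla (hl * hl * hl)))))%fps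
    by (unfold nabla; ring) end.
  unfold fsub, fadd. rewrite !conv_cst.
  rewrite Ws_n, nabla_hl_n, nabla2_hl_n, nabla_hl2_n, nabla2_hl2_n, nabla2_hl3_n by assumption.
  (* The values of [m2] and [m3] make the [z2 ^ 2] terms cancel in the coefficients of [Xn ^ 2] and
     [Xn ^ 3], and the terms linear in [lam] cancel in the latter. *)
  unfold Us_target, ones, m2, m3. field.
- apply dominated_plus; [exact Us_main|].
  apply dominated_plus; [|assumption].
  do 4 (apply dominated_plus; [|apply dominated_scal; assumption]).
  apply dominated_scal; assumption.
Qed.

Lemma dominated_ln_bound (x : nat -> R) : dominated 4 3 x ->
  exists K, 0 <= K /\ forall n, (3 <= n)%nat ->
    Rabs (x n) <= K * (ln (INR n) ^ 3 / INR n ^ 4).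
Proof.
intros [K [HK Hx]].
destruct dominated_mu as [C [HC Hmu]].
(* [harm n] is [ln n + gamma + mu n + 1/n + 1/(n+1)], and [ln n >= 1] for [n >= 3] lets every
   bounded summand be charged to [ln n]. *)
set (c := Rabs euler_gamma + C + 3).
assert (Hc : 0 <= c) by (pose proof (Rabs_pos euler_gamma); unfold c; lra).
exists (K * c ^ 3). split; [apply Rmult_le_pos; [|apply pow_le]; assumption|].
intros n Hn. assert (Hn3 : 3 <= INR n).
{ replace 3 with (INR 3) by (simpl; ring). apply le_INR; assumption. }
assert (Hln : 1 <= ln (INR n)).
{ rewrite <- (ln_exp 1). apply ln_le; [apply exp_pos|]. pose proof exp_le_3; lra. }
assert (Hh : harm n <= c * ln (INR n)).
{ assert (E : harm n = hn n + / INR n + / (INR n + 1)).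
  { rewrite <- Hn_harm, Hn_S. f_equal. unfold hn. destruct n as [|m]; [lia|].
    rewrite Hn_S, S_INR. replace (S m - 1)%nat with m by lia. reflexivity. }
  assert (/ INR n <= / 1) by (apply Rinv_le_contravar; lra).
  assert (/ (INR n + 1) <= / 1) by (apply Rinv_le_contravar; lra).
  specialize (Hmu n). assert (Hw : weight 1 0 n <= 1).
  { apply Rle_trans with (weight 0 0 n); [apply weight_le; lia|]. unfold weight; simpl; lra. }
  assert (mu n <= C).
  { eapply Rle_trans; [apply Rle_abs|]. eapply Rle_trans; [apply Hmu|]. nra. }
  replace (hn n) with (ln (INR n) + euler_gamma + mu n) in E by (unfold mu, lam; ring).
  pose proof (Rle_abs euler_gamma). pose proof (Rabs_pos euler_gamma).
  unfold c. nra. }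
eapply Rle_trans; [apply Hx|]. rewrite Rmult_assoc. apply Rmult_le_compat_l; [assumption|].
unfold weight. pose proof (harm_ge1 n).
replace (c ^ 3 * (ln (INR n) ^ 3 / INR n ^ 4)) with ((c * ln (INR n)) ^ 3 * / INR n ^ 4)
  by (field; lra).
apply Rmult_le_compat.
- apply pow_le; lra.
- left; apply Rinv_0_lt_compat, pow_lt; lra.
- apply pow_incr; lra.
- apply Rinv_le_contravar; [apply pow_lt; lra|]. apply pow_incr; lra.
Qed.

(** * The value of [zeta(2)] *)

Definition cosint (n : nat) : R := RInt (fun x => cos x ^ (2 * n)) 0 (PI / 2).
Definition cosint2 (n : nat) : R := RInt (fun x => x ^ 2 * cos x ^ (2 * n)) 0 (PI / 2).

Lemma is_RInt_cosint (n : nat) :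
  is_RInt (fun x => cos x ^ (2 * n)) 0 (PI / 2) (cosint n).
Proof.
apply (RInt_correct (V := R_CompleteNormedModule)), (ex_RInt_continuous (V := R_CompleteNormedModule)).
intros x _. apply (ex_derive_continuous (fun x => cos x ^ (2 * n))). auto_derive. trivial.
Qed.

Lemma is_RInt_cosint2 (n : nat) :
  is_RInt (fun x => x ^ 2 * cos x ^ (2 * n)) 0 (PI / 2) (cosint2 n).
Proof.
apply (RInt_correct (V := R_CompleteNormedModule)), (ex_RInt_continuous (V := R_CompleteNormedModule)).
intros x _. apply (ex_derive_continuous (fun x => x ^ 2 * cos x ^ (2 * n))). auto_derive. trivial.
Qed.

(** Wallis recurrence: the combination of integrands is the derivative of [sin x cos^(2n+1) x],
    which vanishes at both ends. *)
Lemma cosint_S (n : nat) : (2 * INR n + 2) * cosint (S n) = (2 * INR n + 1) * cosint n.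
Proof.
assert (H1 := is_RInt_minus _ _ _ _ _ _
  (is_RInt_scal _ _ _ (2 * INR n + 2) _ (is_RInt_cosint (S n)))
  (is_RInt_scal _ _ _ (2 * INR n + 1) _ (is_RInt_cosint n))).
assert (H2 : is_RInt (fun x => (2 * INR n + 2) * cos x ^ (2 * S n) - (2 * INR n + 1) * cos x ^ (2 * n))
  0 (PI / 2) (sin (PI / 2) * cos (PI / 2) ^ (2 * n + 1) - sin 0 * cos 0 ^ (2 * n + 1))).
{ apply (is_RInt_derive (fun x => sin x * cos x ^ (2 * n + 1))).
  - intros x _. auto_derive; [trivial|].
    change (n + (n + 0))%nat with (2 * n)%nat.
    replace (Nat.pred (2 * n + 1)) with (2 * n)%nat by lia.
    replace (2 * S n)%nat with (2 * n + 2)%nat by lia.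
    rewrite plus_INR, mult_INR, !pow_add. simpl INR.
    assert (Hs := sin2_cos2 x). unfold Rsqr in Hs.
    set (p := cos x ^ (2 * n)). set (s := sin x) in *. set (c := cos x) in *.
    replace (c * (p * c ^ 1)) with (p * c ^ 2) by ring.
    transitivity (p * c ^ 2 - (2 * INR n + 1) * p * (s * s)); [simpl; ring|].
    replace (s * s) with (1 - c * c) by lra. simpl; ring.
  - intros x _.
    apply (ex_derive_continuous (fun x => (2 * INR n + 2) * cos x ^ (2 * S n) - (2 * INR n + 1) * cos x ^ (2 * n))).
    auto_derive. trivial. }
assert (E := is_RInt_unique _ _ _ _ H2).
rewrite cos_PI2, sin_0, pow_i in E by lia.
assert (E' : RInt (fun x => (2 * INR n + 2) * cos x ^ (2 * S n) - (2 * INR n + 1) * cos x ^ (2 * n)) 0 (PI / 2)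
  = (2 * INR n + 2) * cosint (S n) - (2 * INR n + 1) * cosint n).
{ apply is_RInt_unique. exact H1. }
lra.
Qed.

(** Two integrations by parts packed into the single primitive [f], which vanishes at 0 and at
    [PI / 2]. *)
Lemma cosint2_S (n : nat) :
  cosint (S n) = (INR n + 1) * (2 * INR n + 1) * cosint2 n
                 - 2 * (INR n + 1) ^ 2 * cosint2 (S n).
Proof.
assert (H1 := is_RInt_plus _ _ _ _ _ _ (is_RInt_cosint (S n)) (is_RInt_minus _ _ _ _ _ _
  (is_RInt_scal _ _ _ (2 * (INR n + 1) ^ 2) _ (is_RInt_cosint2 (S n)))
  (is_RInt_scal _ _ _ ((INR n + 1) * (2 * INR n + 1)) _ (is_RInt_cosint2 n)))).
set (g := fun x => cos x ^ (2 * S n) + (2 * (INR n + 1) ^ 2 * (x ^ 2 * cos x ^ (2 * S n))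
   - (INR n + 1) * (2 * INR n + 1) * (x ^ 2 * cos x ^ (2 * n)))).
set (f := fun x => x * cos x ^ (2 * n + 2) + (INR n + 1) * x ^ 2 * sin x * cos x ^ (2 * n + 1)).
assert (H2 : is_RInt g 0 (PI / 2) (f (PI / 2) - f 0)).
{ apply (is_RInt_derive f).
  - intros x _. unfold f, g. auto_derive; [trivial|].
    change (n + (n + 0))%nat with (2 * n)%nat.
    replace (Nat.pred (2 * n + 1)) with (2 * n)%nat by lia.
    replace (Nat.pred (2 * n + 2)) with (2 * n + 1)%nat by lia.
    replace (2 * S n)%nat with (2 * n + 2)%nat by lia.
    rewrite !plus_INR, mult_INR, !pow_add. simpl INR. simpl Nat.pred.
    assert (Hs := sin2_cos2 x). unfold Rsqr in Hs.
    set (p := cos x ^ (2 * n)). set (s := sin x) in *. set (c := cos x) in *.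
    set (k := INR n).
    transitivity (p * c ^ 2 + (k + 1) * x ^ 2 * (p * c ^ 2)
       - (k + 1) * (2 * k + 1) * x ^ 2 * p * (s * s)); [simpl; ring|].
    replace (s * s) with (1 - c * c) by lra. simpl; ring.
  - intros x _. apply (ex_derive_continuous g). unfold g. auto_derive. trivial. }
assert (E := is_RInt_unique _ _ _ _ H2). unfold f in E.
rewrite cos_PI2, !(pow_i (2 * n + _)) in E by lia.
assert (E' : RInt g 0 (PI / 2) = cosint (S n) + (2 * (INR n + 1) ^ 2 * cosint2 (S n)
   - (INR n + 1) * (2 * INR n + 1) * cosint2 n)).
{ apply is_RInt_unique. exact H1. }
lra.
Qed.

Lemma x_cos_le_sin (x : R) : 0 <= x -> x * cos x <= sin x \/ PI < x.
Proof.
intro Hx. destruct (Rle_lt_dec x PI) as [Hp|Hp]; [left|right; assumption].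
destruct (MVT_gen (fun t => sin t - t * cos t) 0 x (fun t => t * sin t)) as [c [Hc E]].
- intros t _. auto_derive; [trivial|]. ring.
- intros t _. apply (continuity_pt_filterlim (fun t => sin t - t * cos t)).
  apply (ex_derive_continuous (fun t => sin t - t * cos t)). auto_derive. trivial.
- rewrite Rmin_left, Rmax_right in Hc by lra. rewrite sin_0 in E.
  assert (0 <= sin c) by (apply sin_ge_0; lra).
  assert (0 <= c * sin c * (x - 0)) by (repeat apply Rmult_le_pos; lra). lra.
Qed.

(** From [x cos x <= sin x], the integrand is at most [sin^2 x cos^(2n) x]. With the Wallis
    recurrence this makes the quotient of the two integrals tend to 0. *)
Lemma cosint2_le (n : nat) : 0 <= cosint2 (S n) <= cosint n - cosint (S n).
Proof.
pose proof PI_RGT_0 as HPI. split.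
- apply RInt_ge_0; [lra| exists (cosint2 (S n)); apply is_RInt_cosint2 |].
  intros x Hx. apply Rmult_le_pos; [apply pow2_ge_0|]. apply pow_le.
  left; apply cos_gt_0; lra.
- assert (H := is_RInt_minus _ _ _ _ _ _ (is_RInt_cosint n) (is_RInt_cosint (S n))).
  apply (is_RInt_le _ _ 0 (PI / 2) _ _ ltac:(lra) (is_RInt_cosint2 (S n)) H).
  intros x Hx. change (minus (cos x ^ (2 * n)) (cos x ^ (2 * S n)))
    with (cos x ^ (2 * n) - cos x ^ (2 * S n)).
  replace (2 * S n)%nat with (2 * n + 2)%nat by lia. rewrite pow_add.
  assert (Hc : 0 < cos x) by (apply cos_gt_0; lra).
  destruct (x_cos_le_sin x) as [Hs|Hs]; [lra| |lra].
  assert (Hs2 := sin2_cos2 x). unfold Rsqr in Hs2.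
  assert (Hp : 0 <= cos x ^ (2 * n)) by (apply pow_le; lra).
  assert (x * cos x * (x * cos x) <= sin x * sin x) by (apply Rmult_le_compat; nra).
  set (p := cos x ^ (2 * n)) in *. simpl. nra.
Qed.

Lemma cosint_0 : cosint 0 = PI / 2.
Proof.
apply is_RInt_unique. apply (is_RInt_ext (fun _ => 1)); [intros; reflexivity|].
assert (H := is_RInt_const 0 (PI / 2) (1 : R)).
change (scal (PI / 2 - 0) 1) with ((PI / 2 - 0) * 1) in H.
replace ((PI / 2 - 0) * 1) with (PI / 2) in H by field. exact H.
Qed.

Lemma cosint2_0 : cosint2 0 = PI ^ 3 / 24.
Proof.
apply is_RInt_unique.
replace (PI ^ 3 / 24) with ((PI / 2) ^ 3 / 3 - 0 ^ 3 / 3) by field.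
apply (is_RInt_derive (fun x => x ^ 3 / 3)).
- intros x _. auto_derive; [trivial|]. simpl; field.
- intros x _. apply (ex_derive_continuous (fun x => x ^ 2 * cos x ^ (2 * 0))). auto_derive. trivial.
Qed.

Lemma cosint_pos (n : nat) : 0 < cosint n.
Proof.
induction n as [|n IH].
- rewrite cosint_0. pose proof PI_RGT_0; lra.
- pose proof (cosint_S n). pose proof (pos_INR n). nra.
Qed.

(* Matsuoka: with [I n] and [J n] the integrals of [cos^(2n)] and
   [x^2 cos^(2n)], one has [1/(2 n^2) = J (n-1) / I (n-1) - J n / I n]. *)
Lemma basel : z2 = PI ^ 2 / 6.
Proof.
set (r := fun n => 2 * (cosint2 n / cosint n)).
assert (Hr : forall n, r n - r (S n) = ipow 2 (S n)).
{ intro n. unfold r, ipow. pose proof (cosint_pos n). pose proof (cosint_pos (S n)).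
  pose proof (cosint_S n) as E1. pose proof (cosint2_S n) as E2. pose proof (pos_INR n).
  rewrite S_INR. set (k := INR n) in *.
  assert (E3 : cosint n = (2 * k + 2) / (2 * k + 1) * cosint (S n)).
  { apply Rmult_eq_reg_l with (2 * k + 1); [|lra]. rewrite <- E1. field. lra. }
  assert (E4 : cosint2 n = (cosint (S n) + 2 * (k + 1) ^ 2 * cosint2 (S n))
                            / ((k + 1) * (2 * k + 1))).
  { rewrite E2 at 1. field. lra. }
  rewrite E4, E3. field. repeat split; lra. }
assert (Hlim : is_lim_seq r 0).
{ apply is_lim_seq_incr_1.
  apply (is_lim_seq_le_le (fun _ => 0) _ (fun n => 2 * / (INR n + 1))).
  - intro n. unfold r. pose proof (cosint2_le n). pose proof (cosint_pos (S n)).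
    pose proof (cosint_S n) as E1. pose proof (pos_INR n). split.
    + apply Rmult_le_pos; [lra|]. apply Rdiv_le_0_compat; lra.
    + apply Rmult_le_compat_l; [lra|].
      apply Rmult_le_reg_r with (cosint (S n)); [assumption|].
      unfold Rdiv. rewrite Rmult_assoc, Rinv_l, Rmult_1_r by lra.
      apply Rle_trans with (1 := proj2 H).
      apply Rmult_le_reg_l with ((INR n + 1) * (2 * INR n + 1)); [nra|].
      replace ((INR n + 1) * (2 * INR n + 1) * (/ (INR n + 1) * cosint (S n)))
        with ((2 * INR n + 1) * cosint (S n)) by (field; lra).
      replace ((INR n + 1) * (2 * INR n + 1) * (cosint n - cosint (S n)))
        with ((INR n + 1) * ((2 * INR n + 1) * cosint n - (2 * INR n + 1) * cosint (S n))) by ring.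
      rewrite <- E1. nra.
  - apply is_lim_seq_const.
  - replace (Finite 0) with (Rbar_mult 2 0) by (simpl; f_equal; ring).
    apply is_lim_seq_scal_l, (is_lim_seq_inv_shift 0). }
unfold z2. rewrite Series_incr_1 by apply (ex_series_ipow 0).
rewrite <- (Series_ext _ _ Hr), (is_series_unique _ _ (is_series_telescope r Hlim)).
unfold r. rewrite cosint_0, cosint2_0. simpl. field. apply Rgt_not_eq, PI_RGT_0.
Qed.

(** * Complex power series *)

Lemma is_series_C (a : nat -> C) (l : C) :
  @is_series C_AbsRing C_NormedModule a l <->
  is_series (fun n => Re (a n)) (Re l) /\ is_series (fun n => Im (a n)) (Im l).
Proof.
assert (E : forall n, @sum_n C_AbelianMonoid a n
  = (sum_n (fun n => Re (a n)) n, sum_n (fun n => Im (a n)) n)).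
{ induction n as [|n IH].
  - rewrite !sum_O. destruct (a 0%nat); reflexivity.
  - rewrite !sum_Sn, IH. destruct (a (S n)); reflexivity. }
split.
- intro H. assert (H' := proj1 (filterlim_locally (U := C_UniformSpace) _ _) H).
  split; apply (filterlim_locally (U := R_UniformSpace)); intro e; specialize (H' e);
    revert H'; apply filter_imp; intros n Hn; rewrite E in Hn; apply Hn.
- intros [H1 H2]. apply (filterlim_locally (U := C_UniformSpace)). intro e.
  assert (H1' := proj1 (filterlim_locally (U := R_UniformSpace) _ _) H1 e).
  assert (H2' := proj1 (filterlim_locally (U := R_UniformSpace) _ _) H2 e).
  generalize (filter_and _ _ H1' H2'). apply filter_imp. intros n Hn.
  rewrite E. exact Hn.
Qed.

Lemma is_series_head (u : nat -> R) (l : R) :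
  u O = l -> (forall n, u (S n) = 0) -> is_series u l.
Proof.
intros H0 HS.
assert (T : is_lim_seq (fun n => match n with O => l | S _ => 0 end) 0).
{ apply is_lim_seq_incr_1, is_lim_seq_const. }
apply is_series_telescope in T. revert T. apply is_series_ext.
intros [|n]; [rewrite H0 | rewrite HS]; apply Rminus_0_r.
Qed.

Lemma pow_n_Cpow (z : C) (n : nat) : @pow_n C_Ring z n = Cpow z n.
Proof. induction n as [|n IH]; [reflexivity|]. simpl. rewrite IH. reflexivity. Qed.

Lemma Re_RtoC_mult (x : R) (z : C) : Re (Cmult (RtoC x) z) = x * Re z.
Proof. unfold Re, Cmult, RtoC; simpl; ring. Qed.

Lemma Im_RtoC_mult (x : R) (z : C) : Im (Cmult (RtoC x) z) = x * Im z.
Proof. unfold Im, Cmult, RtoC; simpl; ring. Qed.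

Lemma Rabs_component_Cpow (z : C) (n : nat) :
  Rabs (Re (Cpow z n)) <= Cmod z ^ n /\ Rabs (Im (Cpow z n)) <= Cmod z ^ n.
Proof.
rewrite <- Cmod_pow. assert (H := Rmax_Cmod (Cpow z n)).
split; (eapply Rle_trans; [|exact H]); [apply Rmax_l | apply Rmax_r].
Qed.

Definition re_term (z : C) (x : nat -> R) (n : nat) : R := x n * Re (Cpow z n).
Definition im_term (z : C) (x : nat -> R) (n : nat) : R := x n * Im (Cpow z n).

Lemma ex_series_terms (z : C) (x : nat -> R) (M : R) :
  Cmod z < 1 -> (forall n, Rabs (x n) <= M) ->
  ex_series (fun n => Rabs (re_term z x n)) /\ ex_series (fun n => Rabs (im_term z x n)).
Proof.
intros Hz HM. pose proof (Cmod_ge_0 z) as H0.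
assert (G : ex_series (fun n => M * Cmod z ^ n)).
{ exists (M * / (1 - Cmod z)). apply (is_series_scal_l M (fun n => Cmod z ^ n) (/ (1 - Cmod z))).
  apply is_series_geom. rewrite Rabs_pos_eq; assumption. }
split; (apply (@ex_series_le R_AbsRing R_CompleteNormedModule) with (2 := G));
  intro n; change (norm ?u) with (Rabs u); rewrite Rabs_Rabsolu;
  unfold re_term, im_term; rewrite Rabs_mult;
  apply Rmult_le_compat; auto using Rabs_pos; apply Rabs_component_Cpow.
Qed.

Lemma conv_terms (z : C) (x y : nat -> R) (n : nat) :
  re_term z (x * y)%fps n
    = (re_term z x * re_term z y)%fps n - (im_term z x * im_term z y)%fps n /\
  im_term z (x * y)%fps n
    = (re_term z x * im_term z y)%fps n + (im_term z x * re_term z y)%fps n.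
Proof.
unfold re_term at 1, im_term at 3. rewrite !conv_sum, Rmult_comm, scal_sum.
rewrite (Rmult_comm _ (Im _)), scal_sum, <- minus_sum, <- sum_plus.
split; apply sum_eq; intros k Hk; unfold re_term, im_term;
  replace (Cpow z n) with (Cmult (Cpow z k) (Cpow z (n - k)))
    by (rewrite <- Cpow_add_r; f_equal; lia);
  unfold Re, Im, Cmult; simpl; ring.
Qed.

Lemma is_series_conv (z : C) (x y : nat -> R) (Mx My : R) : Cmod z < 1 ->
  (forall n, Rabs (x n) <= Mx) -> (forall n, Rabs (y n) <= My) ->
  is_series (re_term z (x * y)%fps)
    (Series (re_term z x) * Series (re_term z y) - Series (im_term z x) * Series (im_term z y)) /\
  is_series (im_term z (x * y)%fps)
    (Series (re_term z x) * Series (im_term z y) + Series (im_term z x) * Series (re_term z y)).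
Proof.
intros Hz Hx Hy.
destruct (ex_series_terms z x Mx Hz Hx) as [X1 X2].
destruct (ex_series_terms z y My Hz Hy) as [Y1 Y2].
assert (P : forall a b : nat -> R, ex_series (fun n => Rabs (a n)) ->
  ex_series (fun n => Rabs (b n)) -> is_series (a * b)%fps (Series a * Series b)).
{ intros a b Ha Hb.
  apply (is_series_ext (fun n => sum_f_R0 (fun k => a k * b (n - k)%nat) n)).
  - intro n. rewrite conv_sum. reflexivity.
  - apply is_series_mult; try assumption; apply Series_correct, ex_series_Rabs; assumption. }
split.
- apply (is_series_ext (fun n => (re_term z x * re_term z y)%fps n - (im_term z x * im_term z y)%fps n)).
  + intro n. symmetry. apply conv_terms.
  + apply (is_series_minus (V := R_NormedModule) (re_term z x * re_term z y)%fps
      (im_term z x * im_term z y)%fps); apply P; assumption.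
- apply (is_series_ext (fun n => (re_term z x * im_term z y)%fps n + (im_term z x * re_term z y)%fps n)).
  + intro n. symmetry. apply conv_terms.
  + apply (is_series_plus (V := R_NormedModule) (re_term z x * im_term z y)%fps
      (im_term z x * re_term z y)%fps); apply P; assumption.
Qed.

Lemma dominated_bounded (x : nat -> R) : dominated 0 0 x -> exists M, forall n, Rabs (x n) <= M.
Proof.
intros [K [_ H]]. exists K. intro n. specialize (H n). unfold weight in H. simpl in H. lra.
Qed.

Lemma Us_bounded : exists M, forall n, Rabs (Us n) <= M.
Proof.
destruct dominated_Vs as [K [HK H]]. exists (K * 2). intro n. unfold Us.
eapply Rle_trans; [apply Rabs_triang_gen|].
apply Rle_trans with (K * sum_f_R0 (weight 2 0) n).
- rewrite scal_sum. apply sum_Rle. intros k _. specialize (H k). lra.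
- apply Rmult_le_compat_l; [assumption | apply sum_weight2].
Qed.

Lemma ipow3_bounded : exists M, forall n, Rabs (ipow 3 n) <= M.
Proof.
apply dominated_bounded, (dominated_le 3 0 0 0); try lia.
apply (symb_dominated 0), symb_ipow.
Qed.

Lemma Li3_term (z : C) (n : nat) :
  Cdiv (Cpow z (S n)) (Cpow (RtoC (INR (S n))) 3)
  = Cmult (RtoC (ipow 3 (S n))) (Cpow z (S n)).
Proof.
unfold Cdiv. rewrite Cmult_comm. f_equal. unfold ipow.
rewrite RtoC_inv by (apply pow_nonzero, not_0_INR; lia).
rewrite RtoC_pow. reflexivity.
Qed.

Lemma Li3_eq (z : C) :
  ex_series (re_term z (ipow 3)) -> ex_series (im_term z (ipow 3)) ->
  Li3 z = (Series (re_term z (ipow 3)), Series (im_term z (ipow 3))).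
Proof.
intros H1 H2. unfold Li3, CSeries. f_equal.
- rewrite (Series_incr_1 (re_term z (ipow 3))) by assumption.
  unfold re_term at 1. simpl (ipow 3 0). rewrite Rmult_0_l, Rplus_0_l.
  apply Series_ext. intro n. rewrite Li3_term, Re_RtoC_mult. reflexivity.
- rewrite (Series_incr_1 (im_term z (ipow 3))) by assumption.
  unfold im_term at 1. simpl (ipow 3 0). rewrite Rmult_0_l, Rplus_0_l.
  apply Series_ext. intro n. rewrite Li3_term, Im_RtoC_mult. reflexivity.
Qed.

Lemma Li3_1 : Li3 1 = RtoC z3.
Proof.
assert (E : forall n, Cpow 1 n = RtoC 1).
{ induction n as [|n IH]; [reflexivity|]. simpl. rewrite IH. apply Cmult_1_l. }
assert (E1 : forall n, ipow 3 n = re_term 1 (ipow 3) n).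
{ intro n. unfold re_term. rewrite E. simpl. ring. }
assert (E2 : forall n, 0 = im_term 1 (ipow 3) n).
{ intro n. unfold im_term. rewrite E. simpl. ring. }
assert (H0 : is_series (fun _ : nat => 0) 0)
  by (apply is_series_head; reflexivity).
rewrite Li3_eq.
- rewrite <- (Series_ext _ _ E1), <- (Series_ext _ _ E2), (is_series_unique _ _ H0).
  reflexivity.
- apply (ex_series_ext _ _ E1), ex_series_ipow.
- apply (ex_series_ext _ _ E2). exists 0. exact H0.
Qed.

Lemma z3_pos : 0 < z3.
Proof.
replace z3 with (Bs 0); [apply Bs_pos|].
unfold Bs, tail, z3. rewrite (Series_incr_1 (ipow 3)) by apply (ex_series_ipow 1).
simpl (ipow 3 0). rewrite Rplus_0_l. reflexivity.
Qed.

Lemma zeta_3 : zeta 3 = z3.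
Proof.
unfold zeta, z3. rewrite (Series_incr_1 (ipow 3)) by apply (ex_series_ipow 1).
simpl (ipow 3 0). rewrite Rplus_0_l. apply Series_ext. intro n. unfold ipow.
replace 3 with (INR 3) by (simpl; ring). rewrite Rpower_pow; [reflexivity|].
apply lt_0_INR; lia.
Qed.

(** Bounded coefficients converge absolutely in the open unit disk, so [Us_renewal] becomes an
    identity between functions through real and imaginary Cauchy products. *)
Lemma S0_pseries (z : C) : Cmod z < 1 ->
  @is_pseries C_AbsRing C_NormedModule (fun n => RtoC (z3 * Us n)) z (S0 z).
Proof.
intro Hz. destruct ipow3_bounded as [M3 HM3]. destruct Us_bounded as [M HM].
assert (Hc : forall n, Rabs (cst z3 n) <= Rabs z3).
{ intro n. unfold cst, delta. destruct (Nat.eqb 0 n).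
  - rewrite Rmult_1_r; lra.
  - rewrite Rmult_0_r, Rabs_R0. apply Rabs_pos. }
assert (Hx : forall n, Rabs ((cst z3 - ipow 3)%fps n) <= Rabs z3 + M3).
{ intro n. unfold fsub, Rminus. eapply Rle_trans; [apply Rabs_triang|].
  rewrite Rabs_Ropp. apply Rplus_le_compat; auto. }
destruct (is_series_conv z _ _ _ _ Hz Hx HM) as [P1 P2].
rewrite Us_renewal in P1, P2. change f1 with (cst 1) in P1, P2.
destruct (ex_series_terms z _ _ Hz HM3) as [A1 A2].
destruct (ex_series_terms z _ _ Hz HM) as [U1 U2].
apply ex_series_Rabs in A1, A2, U1, U2.
assert (Hcst : forall c, is_series (re_term z (cst c)) c /\ is_series (im_term z (cst c)) 0).
{ intro c.
  split; apply is_series_head; unfold re_term, im_term, cst, delta; intros; simpl; ring. }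
assert (D1 : Series (re_term z (cst z3 - ipow 3)%fps) = z3 - Series (re_term z (ipow 3))).
{ apply is_series_unique.
  apply (is_series_ext (fun n => re_term z (cst z3) n - re_term z (ipow 3) n)).
  - intro n. unfold re_term, fsub. simpl. ring.
  - apply (is_series_minus (V := R_NormedModule) (re_term z (cst z3)) (re_term z (ipow 3)));
      [apply Hcst | apply Series_correct, A1]. }
assert (D2 : Series (im_term z (cst z3 - ipow 3)%fps) = - Series (im_term z (ipow 3))).
{ apply is_series_unique. rewrite <- Rminus_0_l.
  apply (is_series_ext (fun n => im_term z (cst z3) n - im_term z (ipow 3) n)).
  - intro n. unfold im_term, fsub. simpl. ring.
  - apply (is_series_minus (V := R_NormedModule) (im_term z (cst z3)) (im_term z (ipow 3)));
      [apply Hcst | apply Series_correct, A2]. }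
apply is_series_unique in P1, P2.
rewrite (is_series_unique _ _ (proj1 (Hcst 1))) in P1.
rewrite (is_series_unique _ _ (proj2 (Hcst 1))) in P2.
rewrite D1, D2 in P1, P2.
set (w := (Series (re_term z Us), Series (im_term z Us))).
assert (Hw : Cmult (Cminus (RtoC z3) (Li3 z)) w = RtoC 1).
{ rewrite Li3_eq by assumption. unfold w, Cmult, Cminus, Cplus, Copp, RtoC; simpl.
  f_equal; lra. }
(* The product with [w] being 1, the denominator cannot vanish; no study of its zeros is
   required. *)
assert (Hd : Cminus (RtoC z3) (Li3 z) <> 0).
{ intro E. rewrite E, Cmult_0_l in Hw. apply (f_equal fst) in Hw. simpl in Hw. lra. }
assert (ES : S0 z = Cmult (RtoC z3) w).
{ unfold S0. rewrite Li3_1. unfold Cdiv. f_equal.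
  rewrite <- (Cmult_1_r (Cinv _)). rewrite <- Hw.
  rewrite Cmult_assoc, Cinv_l by assumption. apply Cmult_1_l. }
rewrite ES. unfold is_pseries. apply is_series_C.
rewrite Re_RtoC_mult, Im_RtoC_mult. split.
- apply (is_series_ext (fun n => z3 * re_term z Us n)).
  + intro n. rewrite pow_n_Cpow. unfold re_term.
    change (scal (Cpow z n) (RtoC (z3 * Us n))) with (Cmult (Cpow z n) (RtoC (z3 * Us n))).
    rewrite Cmult_comm, Re_RtoC_mult. simpl. ring.
  + apply (is_series_scal_l z3 (re_term z Us) (Series (re_term z Us))). apply Series_correct, U1.
- apply (is_series_ext (fun n => z3 * im_term z Us n)).
  + intro n. rewrite pow_n_Cpow. unfold im_term.
    change (scal (Cpow z n) (RtoC (z3 * Us n))) with (Cmult (Cpow z n) (RtoC (z3 * Us n))).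
    rewrite Cmult_comm, Im_RtoC_mult. simpl. ring.
  + apply (is_series_scal_l z3 (im_term z Us) (Series (im_term z Us))). apply Series_correct, U2.
Qed.

(** * Uniqueness of the coefficients and conclusion *)

Lemma CV_radius_pos (a : nat -> R) (x : R) : x <> 0 -> ex_pseries a x -> Rbar_lt 0 (CV_radius a).
Proof.
intros Hx He. destruct (Rbar_le_lt_dec (CV_radius a) 0) as [H|H]; [exfalso|exact H].
apply (CV_disk_outside a x).
- eapply Rbar_le_lt_trans; [exact H|]. apply Rabs_pos_lt, Hx.
- apply ex_series_lim_0. revert He. apply ex_series_ext.
  intro n. rewrite <- pow_n_pow. apply Rmult_comm.
Qed.

(** Restriction to real [z] suffices: there the real and imaginary parts are real power series, to
    which the real uniqueness theorem applies. *)
Lemma power_series_at_0_unique (f : C -> C) (a b : nat -> C) :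
  power_series_at_0 f a -> power_series_at_0 f b -> forall n, a n = b n.
Proof.
intros [r [Hr Ha]] [r' [Hr' Hb]].
assert (Real : forall (c : nat -> C) (s : R),
  (forall z, Cmod z < s -> @is_pseries C_AbsRing C_NormedModule c z (f z)) ->
  forall x, Rabs x < s -> is_pseries (fun n => Re (c n)) x (Re (f (RtoC x)))
                        /\ is_pseries (fun n => Im (c n)) x (Im (f (RtoC x)))).
{ intros c s H x Hx. specialize (H (RtoC x)). rewrite Cmod_R in H.
  apply H, is_series_C in Hx. destruct Hx as [H1 H2].
  split; [revert H1 | revert H2]; apply is_series_ext; intro n;
    rewrite pow_n_Cpow, <- RtoC_pow, <- pow_n_pow.
  - apply Re_RtoC_mult.
  - apply Im_RtoC_mult. }
assert (Ra := Real a r Ha). assert (Rb := Real b r' Hb).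
set (s := Rmin r r'). assert (Hs : 0 < s) by (apply Rmin_pos; assumption).
assert (s <= r) by apply Rmin_l. assert (s <= r') by apply Rmin_r.
assert (Hs2 : Rabs (s / 2) < s) by (rewrite Rabs_pos_eq; lra).
assert (Near : forall P : R -> Prop, (forall x, Rabs x < s -> P x) -> locally 0 P).
{ intros P HP. exists (mkposreal s Hs). intros x Hx. apply HP.
  unfold ball in Hx; simpl in Hx. unfold AbsRing_ball, abs, minus, plus, opp in Hx; simpl in Hx.
  replace x with (x + - 0) by ring. exact Hx. }
intro n. destruct (a n) as [a1 a2] eqn:E1. destruct (b n) as [b1 b2] eqn:E2.
f_equal.
- change (Re (a1, a2) = Re (b1, b2)). rewrite <- E1, <- E2.
  apply (PSeries_ext_recip (fun n => Re (a n)) (fun n => Re (b n))).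
  + apply (CV_radius_pos _ (s / 2)); [lra|]. exact (ex_intro _ _ (proj1 (Ra (s / 2) ltac:(lra)))).
  + apply (CV_radius_pos _ (s / 2)); [lra|]. exact (ex_intro _ _ (proj1 (Rb (s / 2) ltac:(lra)))).
  + apply Near. intros x Hx.
    rewrite (is_pseries_unique _ _ _ (proj1 (Ra x ltac:(lra)))).
    rewrite (is_pseries_unique _ _ _ (proj1 (Rb x ltac:(lra)))). reflexivity.
- change (Im (a1, a2) = Im (b1, b2)). rewrite <- E1, <- E2.
  apply (PSeries_ext_recip (fun n => Im (a n)) (fun n => Im (b n))).
  + apply (CV_radius_pos _ (s / 2)); [lra|]. exact (ex_intro _ _ (proj2 (Ra (s / 2) ltac:(lra)))).
  + apply (CV_radius_pos _ (s / 2)); [lra|]. exact (ex_intro _ _ (proj2 (Rb (s / 2) ltac:(lra)))).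
  + apply Near. intros x Hx.
    rewrite (is_pseries_unique _ _ _ (proj2 (Ra x ltac:(lra)))).
    rewrite (is_pseries_unique _ _ _ (proj2 (Rb x ltac:(lra)))). reflexivity.
Qed.

Theorem theorem8p1 :
  (exists S : nat -> C, power_series_at_0 S0 S) /\
  (forall S : nat -> C,
     power_series_at_0 S0 S ->
     bigO (fun n => Cminus (S n) (RtoC (S_expansion n))) S_remainder).
Proof.
assert (H : power_series_at_0 S0 (fun n => RtoC (z3 * Us n))).
{ exists 1. split; [lra|]. exact S0_pseries. }
split; [exists (fun n => RtoC (z3 * Us n)); exact H|].
intros S HS.
destruct (dominated_ln_bound _ Us_asymptotics) as [K [HK HB]].
pose proof z3_pos as Hz3. pose proof PI_RGT_0 as HPI.
assert (Hz2 : 0 < z2).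
{ rewrite basel. apply Rdiv_lt_0_compat; [apply pow_lt|]; lra. }
exists (z3 / z2 ^ 4 * K), 3%nat. intros n Hn.
assert (Hn3 : 3 <= INR n).
{ replace 3 with (INR 3) by (simpl; ring). apply le_INR; assumption. }
rewrite (power_series_at_0_unique _ _ _ HS H n), <- RtoC_minus, Cmod_R.
(* Undoes the normalization of [Us_target]; this is where [PI] enters, through [basel]. *)
replace (z3 * Us n - S_expansion n) with (z3 / z2 ^ 4 * (z2 ^ 4 * Us n - Us_target n)).
- assert (Hq : 0 <= z3 / z2 ^ 4).
  { apply Rdiv_le_0_compat; [lra | apply pow_lt; lra]. }
  rewrite Rabs_mult, (Rabs_pos_eq _ Hq), Rmult_assoc.
  apply Rmult_le_compat_l; [assumption|].
  eapply Rle_trans; [apply HB, Hn|]. apply Rmult_le_compat_l; [assumption|].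
  apply Rle_abs.
- unfold S_expansion, Us_target, lam, Xn. rewrite zeta_3, basel.
  field. split; lra.
Qed.
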